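(* Let $A,B>0$ and let $\varepsilon\in(0,1)$. Let $w_{AB}\in C(\mathbb R)$ be defined by $$w_{AB}(x)=\begin{cases}\min\{A\sinh x+\cosh x-1,0\}&x\le0,\\ \max\{B\sinh x-\cosh x+1,0\}&x>0.\end{cases}$$ Then there exists a travelling wave solution $u(x,t)=w_{AB,\varepsilon}(x-c_\varepsilon t)$ of $$u_t=(\varepsilon+\Phi_\varepsilon^2(u))u_{xx}+\Phi_\varepsilon(u)(1-\Phi_\varepsilon^2(u))\sqrt{\varepsilon+\Phi_\varepsilon^2(u)}$$ with velocity $c_\varepsilon=\dfrac{B-A}{2\log\varepsilon}$ such that $w_{AB,\varepsilon}(0)=0$ and $w_{AB,\varepsilon}\to w_{AB}$ in $C_{\mathrm{loc}}(J_{AB})$ as $\varepsilon\to0$, where $J_{AB}=\mathbb R$ if $A,B\ge1$; $J_{AB}=(-\log\frac{1+A}{1-A},\log\frac{1+B}{1-B})$ if $A,B\in(0,1)$; $J_{AB}=(-\infty,\log\frac{1+B}{1-B})$ if $A\ge1$, $0<B<1$; $J_{AB}=(-\log\frac{1+A}{1-A},\infty)$ if $0<A<1$, $B\ge1$.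
   Context: For $\varepsilon>0$, $U_\varepsilon(\phi)=2\int_0^\phi\sqrt{\varepsilon+s^2}\,ds$ is strictly increasing, odd and onto $\mathbb R$; $\Phi_\varepsilon$ denotes its inverse. Convergence in $C_{\mathrm{loc}}(J_{AB})$ means: for every compact $K\subset J_{AB}$, $w_{AB,\varepsilon}$ is defined on $K$ for all sufficiently small $\varepsilon$ and converges uniformly to $w_{AB}$ on $K$. *)

(* Defs.v *)
From Stdlib Require Import Reals ClassicalEpsilon.
From Coquelicot Require Import Coquelicot.
Open Scope R_scope.

Definition U (eps phi : R) : R := 2 * RInt (fun s => sqrt (eps + s ^ 2)) 0 phi.

(* Phi_eps = inverse of U_eps (U_eps is a bijection R -> R for eps > 0):
   Phi_eps(u) is the (unique) phi with U_eps(phi) = u. *)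
Definition Phi (eps u : R) : R := epsilon (inhabits 0) (fun p => U eps p = u).

Definition wAB (A B x : R) : R :=
  if Rle_dec x 0 then Rmin (A * sinh x + cosh x - 1) 0
  else Rmax (B * sinh x - cosh x + 1) 0.

Definition J_left (A : R) : Rbar :=
  if Rle_dec 1 A then m_infty else Finite (- ln ((1 + A) / (1 - A))).
Definition J_right (B : R) : Rbar :=
  if Rle_dec 1 B then p_infty else Finite (ln ((1 + B) / (1 - B))).

Definition in_open (a b : Rbar) (x : R) : Prop := Rbar_lt a x /\ Rbar_lt x b.

Definition speed (A B eps : R) : R := (B - A) / (2 * ln eps).

(* Main.v *)
(** In the variable xi = x - c t the profile satisfies a second order equation
    that degenerates where [w = 0].  With [phi = Phi e (w xi)], [s = sqrt (e + phi^2)] and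
    [z = w' - (-2 c) asinh (phi / sqrt e)] it becomes the autonomous system

      w' = z + (-2 c) asinh (phi / sqrt e),    z' = - phi (1 - phi^2) / s,

    whose right-hand side is globally Lipschitz in [(w, z)] because [U' = 2 s];
    so it has global solutions, and we start at [w = 0], [z = (A + B) / 2].
    For [c = (B - A) / (2 ln e)] the first nonlinearity tends to [(B - A) / 2 sgn w]
    and the second to [- sgn w + w], uniformly for [w] in compact sets avoiding 0: the
    slope jumps from [A] to [B] across [w = 0].  For [x >= 0], [w] grows at least linearly
    through a short initial layer, after which a Gronwall estimate for the
    distance to the limit profile keeps [w] away from 0 as long as the limit
    profile is positive.  The reflection [w(x) -> - w(-x)] exchanges [A] and [B] and
    gives [x <= 0]. *)

Require Import Defs.
From Stdlib Require Import Reals Lra Lia ClassicalChoice ClassicalEpsilon.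
From Coquelicot Require Import Coquelicot.
Open Scope R_scope.

(** * Gronwall estimate and continuation *)

Lemma derive_nonneg_le (f df : R -> R) (a b : R) :
  a <= b ->
  (forall t, a <= t <= b -> is_derive f t (df t)) ->
  (forall t, a <= t <= b -> 0 <= df t) ->
  f a <= f b.
Proof.
  intros Hab Hd Hp.
  destruct (MVT_gen f a b df) as [c [Hc Heq]].
  - intros x; rewrite Rmin_left, Rmax_right by lra; intros; apply Hd; lra.
  - intros x; rewrite Rmin_left, Rmax_right by lra; intros.
    apply derivable_continuous_pt; exists (df x); apply is_derive_Reals, Hd; lra.
  - rewrite Rmin_left, Rmax_right in Hc by lra.
    specialize (Hp c Hc); nra.
Qed.

Lemma gronwall (E dE : R -> R) (K C a b : R) :
  0 <= K -> 0 <= C -> a <= b ->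
  (forall t, a <= t <= b -> is_derive E t (dE t)) ->
  (forall t, a <= t <= b -> dE t <= K * E t + C) ->
  E b <= (E a + C * (b - a)) * exp (K * (b - a)).
Proof.
  intros HK HC Hab Hd Hle.
  (* [G' = C - (E' - K E) exp (- K (t - a))] is nonnegative, because the exponential lies in
     [(0, 1]] and [C >= 0]. *)
  set (G := fun t => C * (t - a) - E t * exp (- K * (t - a))).
  assert (HG : G a <= G b).
  { apply derive_nonneg_le with
      (df := fun t => C - (dE t - K * E t) * exp (- K * (t - a))); trivial.
    - intros t Ht; unfold G; auto_derive.
      + exists (dE t); now apply Hd.
      + replace (Derive (fun x : R => E x) t) with (dE t)
          by (symmetry; apply is_derive_unique, Hd, Ht).
        unfold Rminus; ring.
    - intros t Ht.
      assert (He : 0 < exp (- K * (t - a)) <= 1).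
      { split; [apply exp_pos|].
        rewrite <- exp_0; destruct (Rle_lt_or_eq_dec 0 (K * (t - a))) as [h|h].
        - apply Rmult_le_pos; lra.
        - left; apply exp_increasing; lra.
        - right; f_equal; lra. }
      specialize (Hle t Ht); nra. }
  unfold G in HG.
  replace (C * (a - a) - E a * exp (- K * (a - a))) with (- E a) in HG.
  2:{ replace (- K * (a - a)) with 0 by ring; rewrite exp_0; ring. }
  assert (Hinv : exp (- K * (b - a)) * exp (K * (b - a)) = 1).
  { rewrite <- exp_plus; replace (_ + _) with 0 by ring; apply exp_0. }
  assert (Hpos := exp_pos (K * (b - a))).
  replace (E b) with (E b * exp (- K * (b - a)) * exp (K * (b - a)))
    by (rewrite Rmult_assoc, Hinv; ring).
  apply Rmult_le_compat_r; lra.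
Qed.

Lemma continuous_pos_near (f : R -> R) (x : R) :
  continuous f x -> 0 < f x ->
  exists d, 0 < d /\ forall y, Rabs (y - x) < d -> 0 < f y.
Proof.
  intros Hc Hx.
  assert (Hn : locally (f x) (fun u => 0 < u)) by now apply (open_gt 0).
  destruct (Hc _ Hn) as [d Hd]; exists d; split; [apply cond_pos|].
  intros y Hy; now apply Hd.
Qed.

(** A bootstrap principle. At the supremum [m] of the points up to which [f] stays nonnegative, the
    hypothesis gives [0 < f m]; were the conclusion to fail later, continuity would carry
    nonnegativity past [m]. *)
Lemma continuation (f : R -> R) (a b : R) :
  (forall x, continuous f x) -> 0 < f a ->
  (forall x, a <= x <= b -> (forall t, a <= t <= x -> 0 <= f t) -> 0 < f x) ->
  forall x, a <= x <= b -> 0 < f x.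
Proof.
  intros Hc Ha Hstep x Hx.
  destruct (Rlt_le_dec 0 (f x)) as [h|Hneg]; trivial; exfalso.
  set (S := fun t => a <= t <= x /\ forall s, a <= s <= t -> 0 <= f s).
  destruct (completeness S) as [m [Hub Hlub]].
  { exists x; intros t Ht; apply Ht. }
  { exists a; split; [lra|]; intros s Hs; replace s with a by lra; lra. }
  assert (Ham : a <= m).
  { apply Hub; split; [lra|]; intros s Hs; replace s with a by lra; lra. }
  assert (Hmx : m <= x) by (apply Hlub; intros t Ht; apply Ht).
  assert (Hbelow : forall s, a <= s < m -> 0 <= f s).
  { intros s Hs; destruct (Rle_lt_dec 0 (f s)) as [h|h]; trivial; exfalso.
    assert (m <= s); [|lra].
    apply Hlub; intros t [Ht1 Ht2]; destruct (Rle_lt_dec t s) as [k|k]; trivial.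
    specialize (Ht2 s); lra. }
  assert (Hm : 0 <= f m).
  { destruct (Rle_lt_dec 0 (f m)) as [h|h]; trivial; exfalso.
    destruct (continuous_pos_near (fun t => - f t) m) as [d [Hd Hd']]; [|lra|].
    - apply (continuous_opp f m), Hc.
    - destruct (Req_dec m a) as [e|ne]; [subst m; lra|].
      pose (s := Rmax a (m - d / 2)).
      assert (Hs : a <= s < m /\ m - d / 2 <= s).
      { unfold s, Rmax; destruct (Rle_dec a (m - d / 2)); lra. }
      specialize (Hbelow s (proj1 Hs)).
      specialize (Hd' s); rewrite Rabs_left in Hd' by lra; lra. }
  assert (Hmp : 0 < f m).
  { apply Hstep; [lra|]; intros t Ht.
    destruct (Req_dec t m) as [->|ne]; trivial; apply Hbelow; lra. }
  assert (m < x) by (destruct (Req_dec m x) as [e|ne]; [subst m; lra | lra]).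
  destruct (continuous_pos_near f m (Hc m) Hmp) as [d [Hd Hd']].
  pose (s := Rmin x (m + d / 2)).
  assert (Hs : m < s <= x /\ s <= m + d / 2).
  { unfold s, Rmin; destruct (Rle_dec x (m + d / 2)); lra. }
  assert (s <= m); [|lra].
  apply Hub; split; [lra|]; intros t Ht.
  destruct (Rlt_le_dec t m) as [h|h]; [apply Hbelow; lra|].
  left; apply Hd'; rewrite Rabs_right; lra.
Qed.

(** * Global solutions of Lipschitz systems *)

(** The absolute value around the second integral covers [x < 0], where both integrals change
    sign. *)
Lemma abs_RInt_from_0_le (f g : R -> R) (x : R) :
  (forall t, continuous f t) -> (forall t, continuous g t) ->
  (forall t, Rabs (f t) <= g t) ->
  Rabs (RInt f 0 x) <= Rabs (RInt g 0 x).
Proof.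
  intros Hf Hg Hle.
  assert (Hex : forall (u : R -> R) a b, (forall t, continuous u t) -> ex_RInt u a b)
    by (intros; apply (ex_RInt_continuous (V := R_CompleteNormedModule)); intros; auto).
  assert (Hord : forall a b, a <= b -> Rabs (RInt f a b) <= Rabs (RInt g a b)).
  { intros a b Hab; eapply Rle_trans; [|apply Rle_abs].
    eapply Rle_trans; [apply abs_RInt_le; auto|].
    apply RInt_le; auto.
    apply Hex; intros t; apply (continuous_comp f Rabs); auto.
    apply continuous_Rabs. }
  destruct (Rle_lt_dec 0 x) as [h|h]; auto.
  rewrite <- (opp_RInt_swap f), <- (opp_RInt_swap g) by auto.
  unfold opp; simpl; rewrite !Rabs_Ropp; apply Hord; lra.
Qed.

Lemma abs_sinh_le_cosh (x : R) : Rabs (sinh x) <= cosh x.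
Proof.
  unfold sinh, cosh; assert (H1 := exp_pos x); assert (H2 := exp_pos (- x)).
  apply Rabs_le; lra.
Qed.

Lemma abs_le_cosh (x : R) : Rabs x <= cosh x.
Proof.
  unfold cosh; assert (H1 := exp_pos x); assert (H2 := exp_pos (- x)).
  (* This squares [1 + y/2 <= exp (y/2)]. As [(1 + y/2)^2 = 2 y + (1 - y/2)^2], it gives
     [2 y <= exp y]. *)
  assert (Hsq : forall y, 0 <= y -> (1 + y / 2) ^ 2 <= exp y).
  { intros y Hy; replace (exp y) with (exp (y / 2) ^ 2).
    - apply pow_incr; split; [lra | apply exp_ineq1_le].
    - simpl; rewrite Rmult_1_r, <- exp_plus; f_equal; field. }
  apply Rabs_le; destruct (Rle_lt_dec 0 x) as [h|h].
  - specialize (Hsq x h); assert (H3 := pow2_ge_0 (1 - x / 2)); split; nra.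
  - specialize (Hsq (- x) ltac:(lra)); assert (H3 := pow2_ge_0 (1 + x / 2)); split; nra.
Qed.

Lemma geometric_cauchy_limit (u : nat -> R) (c : R) :
  (forall n, Rabs (u (S n) - u n) <= c / 2 ^ n) ->
  exists l, forall n, Rabs (l - u n) <= 2 * c / 2 ^ n.
Proof.
  intros Hu.
  (* The subtracted geometric tail lets the induction on [k] close; dropping it afterwards leaves a
     bound uniform in [k]. *)
  assert (Hm : forall n k, Rabs (u (n + k)%nat - u n) <= 2 * c / 2 ^ n - 2 * c / 2 ^ (n + k)).
  { intros n k; induction k as [|k IH].
    - rewrite Nat.add_0_r; unfold Rminus; rewrite !Rplus_opp_r, Rabs_R0; lra.
    - rewrite Nat.add_succ_r.
      replace (u (S (n + k)) - u n) with
        ((u (S (n + k)) - u (n + k)%nat) + (u (n + k)%nat - u n)) by ring.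
      eapply Rle_trans; [apply Rabs_triang|].
      specialize (Hu (n + k)%nat).
      replace (2 * c / 2 ^ S (n + k)) with (c / 2 ^ (n + k)).
      2:{ simpl; field; apply pow_nonzero; lra. }
      unfold Rdiv in *; lra. }
  assert (Hc : 0 <= c).
  { specialize (Hu 0%nat); simpl in Hu; assert (H := Rabs_pos (u 1%nat - u 0%nat)); lra. }
  assert (Hpos : forall n, 0 <= 2 * c / 2 ^ n).
  { intros n; apply Rmult_le_pos; [lra|]; left; apply Rinv_0_lt_compat, pow_lt; lra. }
  assert (Hm' : forall n k, Rabs (u (n + k)%nat - u n) <= 2 * c / 2 ^ n).
  { intros n k; specialize (Hm n k); specialize (Hpos (n + k)%nat); lra. }
  assert (Hlim : is_lim_seq (fun n => 2 * c / 2 ^ n) 0).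
  { apply is_lim_seq_ext with (fun n => (2 * c) * (/ 2) ^ n).
    - intros n; rewrite pow_inv; reflexivity.
    - replace (Finite 0) with (Rbar_mult (2 * c) 0) by (simpl; f_equal; ring).
      apply is_lim_seq_scal_l, is_lim_seq_geom; rewrite Rabs_right; lra. }
  assert (Hex : ex_finite_lim_seq u).
  { apply ex_lim_seq_cauchy_corr; intros eps.
    destruct (proj2 (is_lim_seq_spec _ _) Hlim (mkposreal _ (is_pos_div_2 eps))) as [N HN].
    exists N; intros n m Hn Hm2.
    specialize (HN N (le_n _)); simpl in HN.
    rewrite Rminus_0_r, Rabs_right in HN by (apply Rle_ge, Hpos).
    replace (u n - u m) with ((u n - u N) - (u m - u N)) by ring.
    eapply Rle_lt_trans; [apply Rabs_triang|]; rewrite Rabs_Ropp.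
    assert (H1 := Hm' N (n - N)%nat); assert (H2 := Hm' N (m - N)%nat).
    replace (N + (n - N))%nat with n in H1 by lia.
    replace (N + (m - N))%nat with m in H2 by lia.
    lra. }
  destruct Hex as [l Hl]; exists l; intros n.
  apply (is_lim_seq_le (fun k => Rabs (u (n + k)%nat - u n)) (fun _ => 2 * c / 2 ^ n)
           (Rabs (l - u n)) (2 * c / 2 ^ n)).
  - intros k; apply Hm'.
  - apply (is_lim_seq_abs _ (l - u n)).
    apply is_lim_seq_minus'; [|apply is_lim_seq_const].
    apply is_lim_seq_ext with (fun k => u (k + n)%nat).
    + intros k; f_equal; lia.
    + now apply is_lim_seq_incr_n.
  - apply is_lim_seq_const.
Qed.

Lemma RInt_cosh (K x : R) : K <> 0 -> RInt (fun t => cosh (K * t)) 0 x = sinh (K * x) / K.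
Proof.
  intros HK; apply is_RInt_unique.
  replace (sinh (K * x) / K) with (minus (sinh (K * x) / K) (sinh (K * 0) / K)).
  2:{ rewrite Rmult_0_r, sinh_0; unfold minus, plus, opp; simpl; field; trivial. }
  apply (is_RInt_derive (fun t => sinh (K * t) / K)).
  - intros t _; unfold sinh, cosh; auto_derive; trivial.
    replace (- (K * t)) with (K * t * -1) by ring; field; trivial.
  - intros t _; apply ex_derive_continuous with (f := fun t => cosh (K * t)).
    unfold cosh; auto_derive; trivial.
Qed.

Section Picard.

Variables (f1 f2 : R -> R -> R) (L y1 y2 : R).
Hypothesis L_pos : 0 < L.
Hypothesis f1_lip : forall a b a' b',
  Rabs (f1 a b - f1 a' b') <= L * (Rabs (a - a') + Rabs (b - b')).
Hypothesis f2_lip : forall a b a' b',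
  Rabs (f2 a b - f2 a' b') <= L * (Rabs (a - a') + Rabs (b - b')).

Lemma lip_continuous (f : R -> R -> R) (u v : R -> R) :
  (forall a b a' b', Rabs (f a b - f a' b') <= L * (Rabs (a - a') + Rabs (b - b'))) ->
  (forall x, continuous u x) -> (forall x, continuous v x) ->
  forall x, continuous (fun t => f (u t) (v t)) x.
Proof.
  intros Hf Hu Hv x.
  apply filterlim_locally; intros eps.
  assert (Hd : 0 < eps / (2 * L)) by (apply Rdiv_lt_0_compat; [apply cond_pos|lra]).
  assert (H1 := proj1 (filterlim_locally _ _) (Hu x) (mkposreal _ Hd)).
  assert (H2 := proj1 (filterlim_locally _ _) (Hv x) (mkposreal _ Hd)).
  generalize (filter_and _ _ H1 H2); apply filter_imp; intros t [h1 h2].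
  change (Rabs (u t - u x) < eps / (2 * L)) in h1.
  change (Rabs (v t - v x) < eps / (2 * L)) in h2.
  change (Rabs (f (u t) (v t) - f (u x) (v x)) < eps).
  eapply Rle_lt_trans; [apply Hf|].
  replace (pos eps) with (L * (eps / (2 * L) + eps / (2 * L))) by (field; lra).
  apply Rmult_lt_compat_l; lra.
Qed.

Fixpoint picard (n : nat) : (R -> R) * (R -> R) :=
  match n with
  | O => (fun _ => y1, fun _ => y2)
  | S m => (fun x => y1 + RInt (fun t => f1 (fst (picard m) t) (snd (picard m) t)) 0 x,
            fun x => y2 + RInt (fun t => f2 (fst (picard m) t) (snd (picard m) t)) 0 x)
  end.

Lemma integral_derive (u : R -> R) (c : R) :
  (forall x, continuous u x) ->
  forall x, is_derive (fun x => c + RInt u 0 x) x (u x).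
Proof.
  intros Hu x.
  replace (u x) with (plus 0 (u x)) by apply Rplus_0_l.
  apply (is_derive_plus (fun _ => c) (fun x => RInt u 0 x)).
  - apply (is_derive_const c).
  - apply (is_derive_RInt u _ 0); [|apply Hu].
    apply filter_forall; intros t.
    apply (RInt_correct u), (ex_RInt_continuous (V := R_CompleteNormedModule)); auto.
Qed.

Lemma integral_continuous (u : R -> R) (c : R) :
  (forall x, continuous u x) ->
  forall x, continuous (fun x => c + RInt u 0 x) x.
Proof.
  intros Hu x; apply (ex_derive_continuous (fun x => c + RInt u 0 x)).
  exists (u x); now apply integral_derive.
Qed.

Lemma picard_continuous (n : nat) :
  (forall x, continuous (fst (picard n)) x) /\ (forall x, continuous (snd (picard n)) x).
Proof.
  induction n as [|n [IH1 IH2]]; simpl.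
  - split; intros x; apply continuous_const.
  - split; apply integral_continuous, lip_continuous; trivial.
Qed.

(* The weight [cosh (K x)] makes the Picard step a contraction with factor 1/2
   on the whole line. *)
Let K := 4 * L.
Let C := (Rabs (f1 y1 y2) + Rabs (f2 y1 y2)) / K.

(** Integrating the weight gains a factor [1 / K]: the antiderivative [sinh (K x) / K] is at most
    [cosh (K x) / K] in absolute value. *)
Lemma integral_diff_le (u v : R -> R) (c D : R) :
  (forall x, continuous u x) -> (forall x, continuous v x) ->
  (forall x, Rabs (u x - v x) <= D * cosh (K * x)) ->
  forall x, Rabs ((c + RInt u 0 x) - (c + RInt v 0 x)) <= D / K * cosh (K * x).
Proof.
  intros Hu Hv Hle x.
  assert (HK : 0 < K) by (unfold K; lra).
  assert (Hex : forall (g : R -> R) a b, (forall t, continuous g t) -> ex_RInt g a b)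
    by (intros; apply (ex_RInt_continuous (V := R_CompleteNormedModule)); intros; auto).
  assert (Hcosh : forall t, continuous (fun t => D * cosh (K * t)) t).
  { intros t; apply ex_derive_continuous with (f := fun t => D * cosh (K * t)).
    unfold cosh; auto_derive; trivial. }
  assert (HD : 0 <= D).
  { specialize (Hle 0); rewrite Rmult_0_r, cosh_0, Rmult_1_r in Hle.
    eapply Rle_trans; [apply Rabs_pos | apply Hle]. }
  replace ((c + RInt u 0 x) - (c + RInt v 0 x)) with (RInt u 0 x - RInt v 0 x) by ring.
  rewrite <- (RInt_minus (V := R_CompleteNormedModule) u v) by auto.
  eapply Rle_trans; [apply abs_RInt_from_0_le with (g := fun t => D * cosh (K * t)); trivial|].
  - intros t; apply (continuous_minus u v); auto.
  - replace (RInt (fun t => D * cosh (K * t)) 0 x) with (D / K * sinh (K * x)).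
    + rewrite Rabs_mult, Rabs_right.
      * apply Rmult_le_compat_l; [|apply abs_sinh_le_cosh].
        apply Rmult_le_pos; [trivial | left; now apply Rinv_0_lt_compat].
      * apply Rle_ge, Rmult_le_pos; [trivial | left; now apply Rinv_0_lt_compat].
    + replace (D / K * sinh (K * x)) with (D * (sinh (K * x) / K)) by (field; lra).
      rewrite <- RInt_cosh by lra; symmetry.
      apply (RInt_scal (V := R_CompleteNormedModule) (fun t => cosh (K * t)) 0 x D).
      apply Hex; intros t; apply (ex_derive_continuous (fun t => cosh (K * t))).
      unfold cosh; auto_derive; trivial.
Qed.

(** The first step is linear in [x] and is absorbed by [|K x| <= cosh (K x)]. Afterwards the
    Lipschitz bound costs [2 L], from two components, and integration gains [1 / K = 1 / (4 L)]. *)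
Lemma picard_step (n : nat) :
  forall x,
    Rabs (fst (picard (S n)) x - fst (picard n) x) <= C * cosh (K * x) / 2 ^ n /\
    Rabs (snd (picard (S n)) x - snd (picard n) x) <= C * cosh (K * x) / 2 ^ n.
Proof.
  assert (HK : 0 < K) by (unfold K; lra).
  induction n as [|n IH].
  - intros x; simpl.
    rewrite !(RInt_const (V := R_CompleteNormedModule)); unfold scal; simpl; unfold mult; simpl.
    assert (H := abs_le_cosh (K * x)); rewrite Rabs_mult, (Rabs_right K) in H by lra.
    assert (Hc : forall y c, Rabs c <= Rabs (f1 y1 y2) + Rabs (f2 y1 y2) ->
                   Rabs (y + (x - 0) * c - y) <= C * cosh (K * x) / 1).
    { intros y c Hcc; replace (y + (x - 0) * c - y) with (c * x) by ring.
      rewrite Rabs_mult; unfold Rdiv; rewrite Rinv_1, Rmult_1_r.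
      replace (Rabs c * Rabs x) with (Rabs c / K * (K * Rabs x)) by (field; lra).
      assert (Hx := Rabs_pos x); assert (Hc0 := Rabs_pos c).
      apply Rmult_le_compat; trivial.
      - apply Rmult_le_pos; [lra | left; now apply Rinv_0_lt_compat].
      - apply Rmult_le_pos; lra.
      - apply Rmult_le_compat_r; [left; now apply Rinv_0_lt_compat | trivial]. }
    assert (H1 := Rabs_pos (f1 y1 y2)); assert (H2 := Rabs_pos (f2 y1 y2)).
    split; apply Hc; lra.
  - destruct (picard_continuous n) as [c1 c2].
    destruct (picard_continuous (S n)) as [c1' c2'].
    assert (Heq : forall x, C * cosh (K * x) / 2 ^ S n
                  = (L * 2 * C / 2 ^ n) / K * cosh (K * x)).
    { intros x; simpl; unfold K; field; split; first [apply pow_nonzero; lra | lra]. }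
    assert (Hb : forall x, L * (Rabs (fst (picard (S n)) x - fst (picard n) x)
                   + Rabs (snd (picard (S n)) x - snd (picard n) x))
                   <= L * 2 * C / 2 ^ n * cosh (K * x)).
    { intros x; destruct (IH x) as [h1 h2].
      replace (L * 2 * C / 2 ^ n * cosh (K * x))
        with (L * (C * cosh (K * x) / 2 ^ n + C * cosh (K * x) / 2 ^ n))
        by (field; apply pow_nonzero; lra).
      apply Rmult_le_compat_l; lra. }
    intros x; rewrite Heq.
    split;
      [ change (fst (picard (S (S n)))) with
          (fun x => y1 + RInt (fun t => f1 (fst (picard (S n)) t) (snd (picard (S n)) t)) 0 x);
        change (fst (picard (S n)) x) with
          (y1 + RInt (fun t => f1 (fst (picard n) t) (snd (picard n) t)) 0 x)
      | change (snd (picard (S (S n)))) with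
          (fun x => y2 + RInt (fun t => f2 (fst (picard (S n)) t) (snd (picard (S n)) t)) 0 x);
        change (snd (picard (S n)) x) with
          (y2 + RInt (fun t => f2 (fst (picard n) t) (snd (picard n) t)) 0 x) ];
      (apply integral_diff_le;
       [ now apply lip_continuous | now apply lip_continuous
       | intros t; eapply Rle_trans; [|apply Hb]; auto ]).
Qed.

(** The convergence is uniform near each point, since [cosh (K t) <= cosh (K x) + 1] for [t] close
    to [x]; the usual three-term splitting applies. *)
Lemma limit_continuous (u : nat -> R -> R) (v : R -> R) :
  (forall n x, continuous (u n) x) ->
  (forall n x, Rabs (v x - u n x) <= 2 * (C * cosh (K * x)) / 2 ^ n) ->
  forall x, continuous v x.
Proof.
  intros Hu Hv x.
  assert (HC : 0 <= C).
  { unfold C, K; apply Rmult_le_pos; [|left; apply Rinv_0_lt_compat; lra].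
    assert (H1 := Rabs_pos (f1 y1 y2)); assert (H2 := Rabs_pos (f2 y1 y2)); lra. }
  apply filterlim_locally; intros eps.
  assert (Hcc : continuous (fun t => cosh (K * t)) x).
  { apply ex_derive_continuous with (f := fun t => cosh (K * t)).
    unfold cosh; auto_derive; trivial. }
  set (M := 2 * (C * (cosh (K * x) + 1))).
  assert (HM : 0 <= M).
  { assert (H := abs_le_cosh (K * x)); assert (H0 := Rabs_pos (K * x)).
    unfold M; apply Rmult_le_pos; [lra | apply Rmult_le_pos; lra]. }
  assert (Hn : exists n, M / 2 ^ n < eps / 3).
  { assert (He := cond_pos eps).
    assert (Hlim := is_lim_seq_geom (/ 2)); rewrite Rabs_right in Hlim by lra.
    specialize (Hlim ltac:(lra)).
    assert (Hq : 0 < eps / 3 / (M + 1)) by (apply Rdiv_lt_0_compat; lra).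
    destruct (proj2 (is_lim_seq_spec _ _) Hlim (mkposreal _ Hq)) as [N HN].
    exists N; specialize (HN N (le_n _)); simpl in HN.
    rewrite Rminus_0_r, pow_inv in HN.
    assert (Hp : 0 < / 2 ^ N) by (apply Rinv_0_lt_compat, pow_lt; lra).
    rewrite Rabs_right in HN by lra.
    apply Rle_lt_trans with ((M + 1) * / 2 ^ N); [unfold Rdiv; nra|].
    replace (eps / 3) with ((M + 1) * (eps / 3 / (M + 1))) by (field; lra).
    apply Rmult_lt_compat_l; lra. }
  destruct Hn as [n Hn].
  assert (He3 : 0 < eps / 3) by (assert (He := cond_pos eps); lra).
  assert (H1 := proj1 (filterlim_locally _ _) Hcc (mkposreal 1 Rlt_0_1)).
  assert (H2 := proj1 (filterlim_locally _ _) (Hu n x) (mkposreal _ He3)).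
  generalize (filter_and _ _ H1 H2); apply filter_imp; intros t [h1 h2].
  change (Rabs (cosh (K * t) - cosh (K * x)) < 1) in h1.
  change (Rabs (u n t - u n x) < eps / 3) in h2.
  change (Rabs (v t - v x) < eps).
  replace (v t - v x) with ((v t - u n t) + ((u n t - u n x) - (v x - u n x))) by ring.
  assert (Hb : forall s, cosh (K * s) <= cosh (K * x) + 1 -> Rabs (v s - u n s) < eps / 3).
  { intros s Hs; eapply Rle_lt_trans; [apply Hv|].
    eapply Rle_lt_trans; [|apply Hn].
    apply Rmult_le_compat_r; [left; apply Rinv_0_lt_compat, pow_lt; lra|].
    unfold M; apply Rmult_le_compat_l; [lra|]; apply Rmult_le_compat_l; lra. }
  apply Rabs_def2 in h1.
  assert (b1 := Hb t ltac:(lra)); assert (b2 := Hb x ltac:(lra)).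
  apply Rabs_def2 in b1; apply Rabs_def2 in b2; apply Rabs_def2 in h2.
  apply Rabs_def1; lra.
Qed.

Lemma lipschitz_system_solution :
  exists u v : R -> R,
    u 0 = y1 /\ v 0 = y2 /\
    (forall x, is_derive u x (f1 (u x) (v x))) /\
    (forall x, is_derive v x (f2 (u x) (v x))).
Proof.
  assert (HK : 0 < K) by (unfold K; lra).
  destruct (choice (fun x l => forall n, Rabs (l - fst (picard n) x) <= 2 * (C * cosh (K * x)) / 2 ^ n))
    as [u Hu].
  { intros x; apply geometric_cauchy_limit; intros n; apply picard_step. }
  destruct (choice (fun x l => forall n, Rabs (l - snd (picard n) x) <= 2 * (C * cosh (K * x)) / 2 ^ n))
    as [v Hv].
  { intros x; apply geometric_cauchy_limit; intros n; apply picard_step. }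
  assert (cu : forall x, continuous u x).
  { apply limit_continuous with (u := fun n => fst (picard n)); [apply picard_continuous | auto]. }
  assert (cv : forall x, continuous v x).
  { apply limit_continuous with (u := fun n => snd (picard n)); [apply picard_continuous | auto]. }
  (* The integral equation passes to the limit: the error of iterate [S n] and the error of its
     integrand each contribute [C cosh (K x) / 2^n]. *)
  assert (Hint : forall (f : R -> R -> R) (w : R -> R) (c : R) (p : nat -> R -> R),
    (forall a b a' b', Rabs (f a b - f a' b') <= L * (Rabs (a - a') + Rabs (b - b'))) ->
    (forall n x, p (S n) x = c + RInt (fun t => f (fst (picard n) t) (snd (picard n) t)) 0 x) ->
    (forall x n, Rabs (w x - p n x) <= 2 * (C * cosh (K * x)) / 2 ^ n) ->
    forall x, w x = c + RInt (fun t => f (u t) (v t)) 0 x).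
  { intros f w c p Hf Hp Hw x.
    set (I := c + RInt (fun t => f (u t) (v t)) 0 x).
    assert (Hlim : is_lim_seq (fun n => 2 * (C * cosh (K * x)) * (/ 2) ^ n) 0).
    { replace (Finite 0) with (Rbar_mult (2 * (C * cosh (K * x))) 0) by (simpl; f_equal; ring).
      apply is_lim_seq_scal_l, is_lim_seq_geom; rewrite Rabs_right; lra. }
    assert (Hle : forall n, Rabs (w x - I) <= 2 * (C * cosh (K * x)) * (/ 2) ^ n).
    { intros n; destruct (picard_continuous n) as [c1 c2].
      assert (H1 := Hw x (S n)); rewrite Hp in H1.
      assert (H2 : Rabs (I - (c + RInt (fun t => f (fst (picard n) t) (snd (picard n) t)) 0 x))
                   <= (4 * L * C / 2 ^ n) / K * cosh (K * x)).
      { apply integral_diff_le; try (now apply lip_continuous).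
        intros t; eapply Rle_trans; [apply Hf|].
        replace (4 * L * C / 2 ^ n * cosh (K * t)) with
          (L * (2 * (C * cosh (K * t)) / 2 ^ n + 2 * (C * cosh (K * t)) / 2 ^ n))
          by (field; apply pow_nonzero; lra).
        apply Rmult_le_compat_l; [lra|]; apply Rplus_le_compat; auto. }
      replace (2 * (C * cosh (K * x)) * (/ 2) ^ n) with
        (2 * (C * cosh (K * x)) / 2 ^ S n + (4 * L * C / 2 ^ n) / K * cosh (K * x)).
      2:{ rewrite pow_inv; simpl; unfold K; field; split; first [apply pow_nonzero; lra | lra]. }
      rewrite Rabs_minus_sym in H2.
      set (J := c + RInt _ 0 x) in H1, H2.
      replace (w x - I) with ((w x - J) + (J - I)) by ring.
      eapply Rle_trans; [apply Rabs_triang | lra]. }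
    assert (H0 : Rabs (w x - I) <= 0).
    { apply (is_lim_seq_le (fun _ => Rabs (w x - I)) _ (Rabs (w x - I)) 0 Hle);
        [apply is_lim_seq_const | trivial]. }
    assert (H1 := Rabs_pos (w x - I)).
    apply Rminus_diag_uniq; destruct (Req_dec (w x - I) 0) as [e|ne]; trivial.
    apply Rabs_pos_lt in ne; lra. }
  assert (Eu := Hint f1 u y1 (fun n => fst (picard n)) f1_lip (fun n x => eq_refl) Hu).
  assert (Ev := Hint f2 v y2 (fun n => snd (picard n)) f2_lip (fun n x => eq_refl) Hv).
  exists u, v; split; [|split; [|split]].
  - rewrite Eu, RInt_point; apply Rplus_0_r.
  - rewrite Ev, RInt_point; apply Rplus_0_r.
  - intros x.
    apply is_derive_ext with (fun x => y1 + RInt (fun t => f1 (u t) (v t)) 0 x); [now intros; symmetry|].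
    apply (integral_derive (fun t => f1 (u t) (v t)) y1); now apply lip_continuous.
  - intros x.
    apply is_derive_ext with (fun x => y2 + RInt (fun t => f2 (u t) (v t)) 0 x); [now intros; symmetry|].
    apply (integral_derive (fun t => f2 (u t) (v t)) y2); now apply lip_continuous.
Qed.

End Picard.

(** * The transformation U and its inverse *)

Section Transform.

Variable e : R.
Hypothesis e_pos : 0 < e.

Local Notation s p := (sqrt (e + p ^ 2)).

Lemma root_pos (p : R) : 0 < s p.
Proof. apply sqrt_lt_R0; nra. Qed.

Lemma root_sqr (p : R) : s p * s p = e + p ^ 2.
Proof. apply sqrt_sqrt; nra. Qed.

Lemma sqrt_le_root (p : R) : sqrt e <= s p.
Proof. apply sqrt_le_1; nra. Qed.

Lemma abs_lt_root (p : R) : Rabs p < s p.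
Proof. rewrite <- (sqrt_Rsqr_abs p); apply sqrt_lt_1; unfold Rsqr; nra. Qed.

Lemma root_le (p : R) : 0 <= p -> s p <= sqrt e + p.
Proof.
  intros Hp; assert (H := root_pos p); assert (H1 := root_sqr p).
  assert (H2 := sqrt_lt_R0 e e_pos); assert (H3 := sqrt_sqrt e (Rlt_le _ _ e_pos)).
  nra.
Qed.

Lemma is_derive_root (p : R) : is_derive (fun p => s p) p (p / s p).
Proof.
  assert (H := root_pos p); auto_derive; [nra|].
  replace (e + p * (p * 1)) with (e + p ^ 2) by ring; field; lra.
Qed.

Lemma is_derive_U (p : R) : is_derive (U e) p (2 * s p).
Proof.
  assert (Hc : forall x, continuous (fun s => sqrt (e + s ^ 2)) x).
  { intros x; apply (ex_derive_continuous (fun p => s p)).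
    exists (x / s x); apply is_derive_root. }
  apply (is_derive_scal (fun x => RInt (fun s => sqrt (e + s ^ 2)) 0 x) p 2 (s p)).
  apply (is_derive_RInt (fun p => s p) _ 0); [|apply Hc].
  apply filter_forall; intros t; apply (RInt_correct (fun p => s p)).
  apply (ex_RInt_continuous (V := R_CompleteNormedModule)); auto.
Qed.

Lemma U_0 : U e 0 = 0.
Proof. unfold U; rewrite RInt_point; apply Rmult_0_r. Qed.

(** [U e q + U e (- q)] has zero derivative and vanishes at 0. *)
Lemma U_opp (p : R) : U e (- p) = - U e p.
Proof.
  destruct (MVT_gen (fun q => U e q + U e (- q)) 0 p (fun _ => 0)) as [c [_ Hc]].
  - intros q _.
    replace 0 with (plus (2 * s q) (-1 * (2 * s (- q)))).
    + apply (is_derive_plus (U e) (fun q => U e (- q))); [apply is_derive_U|].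
      apply (is_derive_comp (U e) Ropp q (2 * s (- q)) (-1)); [apply is_derive_U|].
      auto_derive; trivial.
    + unfold plus; simpl; replace (- q * (- q * 1)) with (q * (q * 1)) by ring; ring.
  - intros q _; apply derivable_continuous_pt; exists (2 * s q + -1 * (2 * s (- q))).
    apply is_derive_Reals, (is_derive_plus (U e) (fun q => U e (- q))); [apply is_derive_U|].
    apply (is_derive_comp (U e) Ropp q (2 * s (- q)) (-1)); [apply is_derive_U|].
    auto_derive; trivial.
  - rewrite Ropp_0, U_0 in Hc; lra.
Qed.

(** As [U' = 2 s], the derivative bound makes both [K U + f] and [K U - f] nondecreasing. *)
Lemma lipschitz_wrt_U (f df : R -> R) (K : R) :
  (forall p, is_derive f p (df p)) ->
  (forall p, Rabs (df p) <= K * (2 * s p)) ->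
  forall p q, Rabs (f q - f p) <= K * Rabs (U e q - U e p).
Proof.
  intros Hd Hb.
  assert (Hord : forall p q, p <= q -> Rabs (f q - f p) <= K * (U e q - U e p)).
  { intros p q Hpq; apply Rabs_le; split.
    - assert (H : K * U e p + f p <= K * U e q + f q); [|lra].
      apply (derive_nonneg_le (fun t => K * U e t + f t) (fun t => K * (2 * s t) + df t)); trivial.
      + intros t _; apply (is_derive_plus (fun t => K * U e t) f); [|apply Hd].
        apply is_derive_scal, is_derive_U.
      + intros t _; specialize (Hb t); apply Rabs_le_between in Hb; lra.
    - assert (H : K * U e p - f p <= K * U e q - f q); [|lra].
      apply (derive_nonneg_le (fun t => K * U e t - f t) (fun t => K * (2 * s t) - df t)); trivial.
      + intros t _; apply (is_derive_minus (fun t => K * U e t) f); [|apply Hd].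
        apply is_derive_scal, is_derive_U.
      + intros t _; specialize (Hb t); apply Rabs_le_between in Hb; lra. }
  assert (Hmono : forall p q, p <= q -> U e p <= U e q).
  { intros p q Hpq; apply (derive_nonneg_le (U e) (fun t => 2 * s t)); trivial.
    - intros t _; apply is_derive_U.
    - intros t _; assert (H := root_pos t); lra. }
  intros p q; destruct (Rle_lt_dec p q) as [h|h].
  - rewrite (Rabs_right (U e q - U e p)); [now apply Hord|].
    specialize (Hmono p q h); lra.
  - rewrite Rabs_minus_sym, (Rabs_minus_sym (U e q)), (Rabs_right (U e p - U e q)).
    + apply Hord; lra.
    + specialize (Hmono q p); lra.
Qed.

(** The slope of [U e] is at least [2 sqrt e]. Both the injectivity of [U e] and the Lipschitz
    continuity of its inverse follow. *)
Lemma abs_le_U_diff (p q : R) : Rabs (q - p) <= / (2 * sqrt e) * Rabs (U e q - U e p).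
Proof.
  apply (lipschitz_wrt_U (fun t => t) (fun _ => 1)).
  - intros t; apply (is_derive_id t).
  - intros t; rewrite Rabs_R1.
    assert (H := sqrt_lt_R0 e e_pos); assert (H1 := sqrt_le_root t).
    replace 1 with (/ (2 * sqrt e) * (2 * sqrt e)) at 1 by (field; lra).
    apply Rmult_le_compat_l; [left; apply Rinv_0_lt_compat; lra | lra].
Qed.

Lemma U_inj (p q : R) : U e p = U e q -> p = q.
Proof.
  intros H; assert (H1 := abs_le_U_diff p q).
  rewrite H, Rminus_diag, Rabs_R0, Rmult_0_r in H1.
  assert (H2 := Rabs_pos (q - p)).
  destruct (Req_dec (q - p) 0) as [E|E]; [lra|].
  apply Rabs_pos_lt in E; lra.
Qed.

(** Integrates [t <= s t <= sqrt e + t]. For small [e] this makes [Phi e u] close to [sqrt u]. *)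
Lemma U_bounds (p : R) : 0 <= p -> p ^ 2 <= U e p <= p ^ 2 + 2 * sqrt e * p.
Proof.
  intros Hp; split.
  - assert (H : U e 0 - 0 ^ 2 <= U e p - p ^ 2); [|rewrite U_0 in H; lra].
    apply (derive_nonneg_le (fun t => U e t - t ^ 2) (fun t => 2 * s t - 2 * t)); trivial.
    + intros t _; apply (is_derive_minus (U e) (fun t => t ^ 2)); [apply is_derive_U|].
      auto_derive; trivial; ring.
    + intros t _; assert (H := abs_lt_root t); assert (H1 := Rle_abs t); lra.
  - assert (H : 0 ^ 2 + 2 * sqrt e * 0 - U e 0 <= p ^ 2 + 2 * sqrt e * p - U e p);
      [|rewrite U_0 in H; lra].
    apply (derive_nonneg_le (fun t => t ^ 2 + 2 * sqrt e * t - U e t)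
             (fun t => 2 * t + 2 * sqrt e - 2 * s t)); trivial.
    + intros t _; apply (is_derive_minus (fun t => t ^ 2 + 2 * sqrt e * t) (U e));
        [|apply is_derive_U].
      auto_derive; trivial; ring.
    + intros t Ht; assert (H := root_le t (proj1 Ht)); lra.
Qed.

Lemma U_surj (u : R) : exists p, U e p = u.
Proof.
  assert (Hs := sqrt_lt_R0 e e_pos).
  (* With slope at least [2 sqrt e], [U e] has reached [|u|] by the time its argument is [b]. *)
  set (b := Rabs u / (2 * sqrt e)).
  assert (Hb : 0 <= b).
  { apply Rmult_le_pos; [apply Rabs_pos | left; apply Rinv_0_lt_compat; lra]. }
  assert (HU : Rabs u <= U e b).
  { assert (H : 2 * sqrt e * 0 <= U e b - 2 * sqrt e * b).
    - replace (2 * sqrt e * 0) with (U e 0 - 2 * sqrt e * 0) by (rewrite U_0; ring).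
      apply (derive_nonneg_le (fun t => U e t - 2 * sqrt e * t) (fun t => 2 * s t - 2 * sqrt e));
        trivial.
      + intros t _; apply (is_derive_minus (U e) (fun t => 2 * sqrt e * t)); [apply is_derive_U|].
        auto_derive; trivial; ring.
      + intros t _; assert (H := sqrt_le_root t); lra.
    - replace (Rabs u) with (2 * sqrt e * b) by (unfold b; field; lra); lra. }
  destruct (IVT_gen (U e) (- b) b u) as [p [_ Hp]].
  - intros x; apply derivable_continuous_pt; exists (2 * s x); apply is_derive_Reals, is_derive_U.
  - rewrite U_opp; assert (H := Rabs_pos u); apply Rabs_le_between in HU.
    rewrite Rmin_left, Rmax_right; lra.
  - now exists p.
Qed.

Lemma U_Phi (u : R) : U e (Phi e u) = u.
Proof. apply (epsilon_spec (inhabits 0) (fun p => U e p = u)), U_surj. Qed.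

Lemma Phi_U (p : R) : Phi e (U e p) = p.
Proof. apply U_inj, U_Phi. Qed.

Lemma Phi_opp (u : R) : Phi e (- u) = - Phi e u.
Proof. apply U_inj; rewrite U_opp, !U_Phi; reflexivity. Qed.

Lemma Phi_nonneg (u : R) : 0 <= u -> 0 <= Phi e u.
Proof.
  intros Hu; destruct (Rle_lt_dec 0 (Phi e u)) as [h|h]; trivial; exfalso.
  assert (H := U_bounds (- Phi e u) ltac:(lra)); rewrite U_opp, U_Phi in H.
  assert (0 < (- Phi e u) ^ 2) by (apply pow_lt; lra); lra.
Qed.

Lemma Phi_bounds (u : R) :
  0 <= u -> Phi e u ^ 2 <= u <= Phi e u ^ 2 + 2 * sqrt e * Phi e u.
Proof.
  intros Hu; rewrite <- (U_Phi u) at 2 3; apply U_bounds, Phi_nonneg, Hu.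
Qed.

Lemma Phi_lip (u v : R) : Rabs (Phi e v - Phi e u) <= / (2 * sqrt e) * Rabs (v - u).
Proof. rewrite <- (U_Phi u) at 2; rewrite <- (U_Phi v) at 2; apply abs_le_U_diff. Qed.

(** By the mean value theorem for [U e], the difference quotient equals [/ (2 s c)] with [c] between
    [Phi e u] and [Phi e (u + h)]. The bound [|h| < d (2 sqrt e)] puts [c] within [d] of
    [Phi e u]. *)
Lemma is_derive_Phi (u : R) : is_derive (Phi e) u (/ (2 * s (Phi e u))).
Proof.
  apply is_derive_Reals; intros eps Heps.
  assert (Hs := sqrt_lt_R0 e e_pos).
  assert (Hc : continuous (fun p => / (2 * s p)) (Phi e u)).
  { apply (ex_derive_continuous (fun p => / (2 * s p))).
    assert (H := root_pos (Phi e u)).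
    auto_derive; replace (_ * (_ * 1)) with (Phi e u ^ 2) by ring; split; [nra | split; [lra|trivial]]. }
  destruct (proj1 (filterlim_locally _ _) Hc (mkposreal _ Heps)) as [d Hd].
  assert (Hd2 : 0 < d * (2 * sqrt e)) by (apply Rmult_lt_0_compat; [apply cond_pos | lra]).
  exists (mkposreal _ Hd2); intros h Hh Hlt; simpl in Hlt.
  destruct (MVT_gen (U e) (Phi e u) (Phi e (u + h)) (fun p => 2 * s p)) as [c [Hbc Hc']].
  - intros; apply is_derive_U.
  - intros x _; apply derivable_continuous_pt; exists (2 * s x); apply is_derive_Reals, is_derive_U.
  - rewrite !U_Phi in Hc'.
    replace (Phi e (u + h) - Phi e u) with (h * / (2 * s c)).
    2:{ replace h with (u + h - u) at 1 by ring; rewrite Hc'.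
        assert (H := root_pos c); set (r := s c) in *; field; lra. }
    replace (h * / (2 * s c) / h) with (/ (2 * s c)).
    2:{ assert (H := root_pos c); set (r := s c) in *; field; lra. }
    apply Hd.
    change (Rabs (c - Phi e u) < d).
    assert (Hl := Phi_lip u (u + h)); replace (u + h - u) with h in Hl by ring.
    apply Rle_lt_trans with (Rabs (Phi e (u + h) - Phi e u)).
    + unfold Rmin, Rmax in Hbc; destruct (Rle_dec (Phi e u) (Phi e (u + h))).
      * rewrite !Rabs_right; lra.
      * rewrite !Rabs_left1; lra.
    + eapply Rle_lt_trans; [apply Hl|].
      replace (pos d) with (/ (2 * sqrt e) * (d * (2 * sqrt e))) by (field; lra).
      apply Rmult_lt_compat_l; [apply Rinv_0_lt_compat; lra | trivial].
Qed.

Lemma lipschitz_comp_Phi (f df : R -> R) (K : R) :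
  (forall p, is_derive f p (df p)) ->
  (forall p, Rabs (df p) <= K * (2 * s p)) ->
  forall u v, Rabs (f (Phi e u) - f (Phi e v)) <= K * Rabs (u - v).
Proof.
  intros Hd Hb u v; rewrite <- (U_Phi u) at 2; rewrite <- (U_Phi v) at 2.
  now apply (lipschitz_wrt_U f df).
Qed.

Lemma shifted_root_pos (p : R) : 0 < p + s p.
Proof. assert (H := abs_lt_root p); apply Rabs_def2 in H; lra. Qed.

End Transform.

(** * The two nonlinearities of the system *)

(* [layer k e p = k * asinh (p / sqrt e)] is the jump of the derivative of the
   wave across its transition layer; with [k = -2 c] it makes
   [z = w' - layer k e (Phi e w)] satisfy [z' = - reaction e (Phi e w)]. *)
Definition layer (k e p : R) : R := k * (ln (p + sqrt (e + p ^ 2)) - ln e / 2).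

(** The source term [p (1 - p^2) s] of the equation divided by its diffusion coefficient
    [e + p^2 = s^2]. *)
Definition reaction (e p : R) : R := p * (1 - p ^ 2) / sqrt (e + p ^ 2).

(** Oddness of [asinh], which comes from [(s + p) (s - p) = e]. *)
Lemma layer_opp (k e p : R) : 0 < e -> layer k e (- p) = - layer k e p.
Proof.
  intros He; unfold layer.
  assert (H1 := shifted_root_pos e He p); assert (H2 := shifted_root_pos e He (- p)).
  replace ((- p) ^ 2) with (p ^ 2) in * by ring.
  assert (H : ln (p + sqrt (e + p ^ 2)) + ln (- p + sqrt (e + p ^ 2)) = ln e).
  { rewrite <- ln_mult by trivial; f_equal; assert (H := root_sqr e He p); nra. }
  nra.
Qed.

Lemma reaction_opp (e p : R) : 0 < e -> reaction e (- p) = - reaction e p.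
Proof.
  intros He; unfold reaction; replace ((- p) ^ 2) with (p ^ 2) by ring.
  field; assert (H := root_pos e He p); lra.
Qed.

Lemma is_derive_layer (k e p : R) :
  0 < e -> is_derive (layer k e) p (k / sqrt (e + p ^ 2)).
Proof.
  intros He; unfold layer.
  assert (H := root_pos e He p); assert (H1 := shifted_root_pos e He p).
  auto_derive; replace (p * (p * 1)) with (p ^ 2) in * by ring.
  - split; [nra | split; trivial].
  - field; lra.
Qed.

Lemma is_derive_reaction (e p : R) :
  0 < e ->
  is_derive (reaction e) p
    ((e - 3 * e * p ^ 2 - 2 * p ^ 4) / ((e + p ^ 2) * sqrt (e + p ^ 2))).
Proof.
  intros He; unfold reaction.
  assert (H := root_pos e He p); assert (H1 := root_sqr e He p).
  auto_derive; replace (p * (p * 1)) with (p ^ 2) in * by ring.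
  - split; [nra | split; [lra | trivial]].
  - set (r := sqrt (e + p ^ 2)) in *; rewrite <- H1.
    replace e with (r * r - p ^ 2) by lra; field; lra.
Qed.

(** The ratio of the derivatives of [layer k e] and [U e] is [k / (2 (e + p^2))]. *)
Lemma layer_Phi_lip (k e : R) :
  0 < e ->
  forall u v, Rabs (layer k e (Phi e u) - layer k e (Phi e v)) <= Rabs k / (2 * e) * Rabs (u - v).
Proof.
  intros He; apply (lipschitz_comp_Phi e He (layer k e) (fun p => k / sqrt (e + p ^ 2))).
  - intros p; now apply is_derive_layer.
  - intros p; assert (H := root_pos e He p); assert (H1 := root_sqr e He p).
    set (r := sqrt (e + p ^ 2)) in *.
    unfold Rdiv; rewrite Rabs_mult, Rabs_inv, (Rabs_right r) by lra.
    replace (Rabs k * / (2 * e) * (2 * r)) with (Rabs k * (r / e)) by (field; lra).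
    apply Rmult_le_compat_l; [apply Rabs_pos|].
    apply Rmult_le_reg_l with (r * e); [nra|].
    replace (r * e * / r) with e by (field; lra).
    replace (r * e * (r / e)) with (r * r) by (field; lra).
    nra.
Qed.

(** Divided by [U' = 2 s], the derivative is [(e - 3 e p^2 - 2 p^4) / (2 (e + p^2)^2)]. The term [e]
    contributes at most [/ (2 e)], the other two at most 3 in absolute value. *)
Lemma reaction_Phi_lip (e : R) :
  0 < e ->
  forall u v, Rabs (reaction e (Phi e u) - reaction e (Phi e v))
              <= (/ (2 * e) + 3) * Rabs (u - v).
Proof.
  intros He; apply (lipschitz_comp_Phi e He (reaction e)
    (fun p => (e - 3 * e * p ^ 2 - 2 * p ^ 4) / ((e + p ^ 2) * sqrt (e + p ^ 2)))).
  - intros p; now apply is_derive_reaction.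
  - intros p; assert (H := root_pos e He p); assert (H1 := root_sqr e He p).
    set (r := sqrt (e + p ^ 2)) in *; rewrite <- H1.
    assert (Hie := Rinv_0_lt_compat e He).
    apply Rabs_le_between.
    replace ((/ (2 * e) + 3) * (2 * r)) with
      ((/ e * (r * r) + 6 * (r * r)) * (r * r) / (r * r * r)) by (field; lra).
    assert (Hden : 0 < / (r * r * r)) by (apply Rinv_0_lt_compat; repeat apply Rmult_lt_0_compat; trivial).
    assert (He1 : e <= / e * (r * r) * (r * r)).
    { rewrite H1; replace e with (/ e * (e * e)) at 1 by (field; lra).
      rewrite Rmult_assoc; apply Rmult_le_compat_l; nra. }
    assert (Hq : 0 <= p ^ 2) by nra.
    assert (He2 : 3 * e * p ^ 2 + 2 * p ^ 4 <= 6 * (r * r) * (r * r)).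
    { rewrite H1; replace (p ^ 4) with (p ^ 2 * p ^ 2) by ring; nra. }
    assert (He3 : 0 <= 3 * e * p ^ 2 + 2 * p ^ 4).
    { replace (p ^ 4) with (p ^ 2 * p ^ 2) by ring; nra. }
    unfold Rdiv; rewrite Ropp_mult_distr_l.
    split; apply Rmult_le_compat_r; lra.
Qed.

(** * The first order system *)

(** The coefficient [(A - B) / ln e] is [-2 * speed A B e]. Since [layer] vanishes with [w], the
    slope of [w] at 0 is [(A + B) / 2], the mean of the two limit slopes. *)
Definition wave_system (A B e : R) (w z : R -> R) : Prop :=
  w 0 = 0 /\ z 0 = (A + B) / 2 /\
  (forall x, is_derive w x (z x + layer ((A - B) / ln e) e (Phi e (w x)))) /\
  (forall x, is_derive z x (- reaction e (Phi e (w x)))).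

Lemma wave_system_exists (A B e : R) : 0 < e -> exists w z, wave_system A B e w z.
Proof.
  intros He; set (k := (A - B) / ln e).
  set (L := 1 + Rabs k / (2 * e) + (/ (2 * e) + 3)).
  assert (Hk : 0 <= Rabs k / (2 * e)).
  { apply Rmult_le_pos; [apply Rabs_pos | left; apply Rinv_0_lt_compat; lra]. }
  assert (Hi : 0 < / (2 * e)) by (apply Rinv_0_lt_compat; lra).
  apply (lipschitz_system_solution (fun w z => z + layer k e (Phi e w))
           (fun w _ => - reaction e (Phi e w)) L 0 ((A + B) / 2)).
  - unfold L; lra.
  - intros a b a' b'.
    assert (H := layer_Phi_lip k e He a a').
    assert (H1 := Rabs_pos (a - a')); assert (H2 := Rabs_pos (b - b')).
    replace (b + layer k e (Phi e a) - (b' + layer k e (Phi e a')))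
      with ((b - b') + (layer k e (Phi e a) - layer k e (Phi e a'))) by ring.
    eapply Rle_trans; [apply Rabs_triang|].
    unfold L; nra.
  - intros a b a' b'.
    assert (H := reaction_Phi_lip e He a a').
    assert (H1 := Rabs_pos (a - a')); assert (H2 := Rabs_pos (b - b')).
    replace (- reaction e (Phi e a) - - reaction e (Phi e a'))
      with (- (reaction e (Phi e a) - reaction e (Phi e a'))) by ring.
    rewrite Rabs_Ropp; unfold L; nra.
Qed.

(** [Phi], [layer] and [reaction] are odd, so the reflection only changes the sign of the
    coefficient of [layer], which amounts to exchanging [A] and [B]. *)
Lemma wave_system_reflect (A B e : R) (w z : R -> R) :
  0 < e -> wave_system A B e w z ->
  wave_system B A e (fun x => - w (- x)) (fun x => z (- x)).
Proof.
  intros He (w0 & z0 & Hw & Hz); repeat apply conj.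
  - rewrite Ropp_0, w0; ring.
  - rewrite Ropp_0, z0; lra.
  - intros x; rewrite Phi_opp, layer_opp by trivial.
    replace (z (- x) + - layer ((B - A) / ln e) e (Phi e (w (- x)))) with
      (opp (scal (-1) (z (- x) + layer ((A - B) / ln e) e (Phi e (w (- x)))))).
    2:{ unfold opp, scal, mult, layer, Rdiv; simpl; unfold mult; simpl; ring. }
    apply (is_derive_opp (fun x => w (- x))).
    apply (is_derive_comp w Ropp); [apply Hw|].
    auto_derive; trivial.
  - intros x; rewrite Phi_opp, reaction_opp by trivial.
    replace (- - reaction e (Phi e (w (- x)))) with
      (scal (-1) (- reaction e (Phi e (w (- x))))).
    2:{ unfold scal, mult; simpl; unfold mult; simpl; ring. }
    apply (is_derive_comp z Ropp); [apply Hz|].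
    auto_derive; trivial.
Qed.

Lemma wave_second_derivative (A B e : R) (w z : R -> R) :
  0 < e -> wave_system A B e w z ->
  forall x, is_derive (fun y => z y + layer ((A - B) / ln e) e (Phi e (w y))) x
    (- reaction e (Phi e (w x)) +
     (A - B) / ln e * (z x + layer ((A - B) / ln e) e (Phi e (w x)))
       / (2 * (e + Phi e (w x) ^ 2))).
Proof.
  intros He (_ & _ & Hw & Hz) x.
  apply (is_derive_plus z (fun y => layer ((A - B) / ln e) e (Phi e (w y)))); [apply Hz|].
  set (k := (A - B) / ln e) in *.
  replace (k * (z x + layer k e (Phi e (w x))) / (2 * (e + Phi e (w x) ^ 2))) with
    (scal (scal (z x + layer k e (Phi e (w x))) (/ (2 * sqrt (e + Phi e (w x) ^ 2))))
       (k / sqrt (e + Phi e (w x) ^ 2))).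
  - apply (is_derive_comp (layer k e) (fun y => Phi e (w y)));
      [now apply is_derive_layer|].
    apply (is_derive_comp (Phi e) w); [now apply is_derive_Phi | apply Hw].
  - unfold scal; simpl; unfold mult; simpl.
    assert (H := root_pos e He (Phi e (w x))); assert (H1 := root_sqr e He (Phi e (w x))).
    simpl in H, H1; set (r := sqrt _) in *; rewrite <- H1.
    field; lra.
Qed.

(** Multiplying the formula for [w''] by [e + p^2] turns [- reaction] into minus the source term and
    leaves [k w' / 2], where [k = (A - B) / ln e = -2 c]. *)
Lemma wave_profile_equation (A B e : R) (w z : R -> R) :
  0 < e < 1 -> wave_system A B e w z ->
  forall x, let p := Phi e (w x) in
    - speed A B e * Derive w x =
      (e + p ^ 2) * Derive (Derive w) x + p * (1 - p ^ 2) * sqrt (e + p ^ 2).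
Proof.
  intros He Hs x p.
  assert (Hw1 : forall y, Derive w y = z y + layer ((A - B) / ln e) e (Phi e (w y)))
    by (intros y; apply is_derive_unique, Hs).
  rewrite (Derive_ext _ _ x Hw1).
  rewrite (is_derive_unique (fun y : R => z y + layer ((A - B) / ln e) e (Phi e (w y))) _ _
             (wave_second_derivative A B e w z (proj1 He) Hs x)).
  rewrite Hw1; fold p; set (v := z x + _); unfold speed, reaction.
  assert (H := root_pos e (proj1 He) p); assert (H1 := root_sqr e (proj1 He) p).
  assert (Hl : ln e < 0) by (rewrite <- ln_1; apply ln_increasing; lra).
  set (r := sqrt (e + p ^ 2)) in *; rewrite <- H1; field; lra.
Qed.

(** * Asymptotics of the nonlinearities for small e *)

Lemma ln_le_sub_1 (x : R) : 0 < x -> ln x <= x - 1.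
Proof.
  intros Hx; assert (H := exp_ineq1_le (ln x)); rewrite exp_ln in H; lra.
Qed.

(** With [p = Phi e u] and [r] the root, [sqrt e <= r] gives the lower bound. The upper one is [ln
    (p + r) <= p + r - 1 <= 2 p <= 1 + p^2 <= 1 + u]. *)
Lemma ln_shifted_root_bounds (e u : R) :
  0 < e < 1 -> 0 <= u ->
  ln e / 2 <= ln (Phi e u + sqrt (e + Phi e u ^ 2)) <= 1 + u.
Proof.
  intros He Hu.
  assert (Hp := Phi_nonneg e (proj1 He) u Hu); assert (Hb := Phi_bounds e (proj1 He) u Hu).
  assert (Hs := sqrt_le_root e (proj1 He) (Phi e u)).
  assert (Hr := root_le e (proj1 He) (Phi e u) Hp).
  assert (Hq := sqrt_lt_R0 e (proj1 He)).
  assert (Hq1 : sqrt e <= 1) by (rewrite <- sqrt_1; apply sqrt_le_1; lra).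
  set (p := Phi e u) in *; set (r := sqrt (e + p ^ 2)) in *; split.
  - replace (ln e / 2) with (ln (sqrt e)).
    + apply ln_le; lra.
    + rewrite <- (sqrt_sqrt e) at 2 by lra; rewrite ln_mult by trivial; field.
  - assert (H := ln_le_sub_1 (p + r)); assert (0 <= (1 - p) ^ 2) by apply pow2_ge_0; nra.
Qed.

(** Away from [u = 0] the lower bound no longer depends on [e]:
    [d <= u <= p^2 + 2 sqrt e p <= (p + r)^2]. *)
Lemma ln_shifted_root_lower (e u d : R) :
  0 < e < 1 -> 0 < d <= u -> ln d / 2 <= ln (Phi e u + sqrt (e + Phi e u ^ 2)).
Proof.
  intros He Hu.
  assert (Hp := Phi_nonneg e (proj1 He) u ltac:(lra)).
  assert (Hb := Phi_bounds e (proj1 He) u ltac:(lra)).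
  assert (Hs := sqrt_le_root e (proj1 He) (Phi e u)).
  assert (Hq := sqrt_lt_R0 e (proj1 He)).
  set (p := Phi e u) in *; set (r := sqrt (e + p ^ 2)) in *.
  assert (Hd := sqrt_lt_R0 d (proj1 Hu)).
  replace (ln d / 2) with (ln (sqrt d)).
  - apply ln_le; trivial.
    apply Rsqr_incr_0_var; [|lra].
    rewrite Rsqr_sqrt by lra; unfold Rsqr; nra.
  - rewrite <- (sqrt_sqrt d) at 2 by lra; rewrite ln_mult by trivial; field.
Qed.

(** [(B - A) / 2] is exactly the part of [layer] containing [ln e / 2]. The remainder is of order
    [1 / |ln e|] wherever the other logarithm stays bounded. *)
Lemma layer_deviation (A B e p : R) :
  0 < e < 1 ->
  layer ((A - B) / ln e) e p - (B - A) / 2 = (A - B) / ln e * ln (p + sqrt (e + p ^ 2)).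
Proof.
  intros He; unfold layer.
  assert (Hl : ln e < 0) by (rewrite <- ln_1; apply ln_increasing; lra).
  field; lra.
Qed.

(** Serves inside the transition layer, where [u] may be near 0 and [layer] need not be close to its
    limit: up to an error of order [1 / |ln e|] it never exceeds half the slope jump. *)
Lemma layer_bound (A B e u : R) :
  0 < e < 1 ->
  Rabs (layer ((A - B) / ln e) e (Phi e u))
    <= Rabs (B - A) / 2 + Rabs (B - A) * (1 + Rabs u) / - ln e.
Proof.
  intros He.
  assert (Hl : ln e < 0) by (rewrite <- ln_1; apply ln_increasing; lra).
  assert (Hpos : forall v, 0 <= v -> Rabs (layer ((A - B) / ln e) e (Phi e v))
     <= Rabs (B - A) / 2 + Rabs (B - A) * (1 + v) / - ln e).
  { intros v Hv; assert (H := ln_shifted_root_bounds e v He Hv); unfold layer.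
    set (y := ln (Phi e v + _)) in *.
    replace ((A - B) / ln e * (y - ln e / 2)) with ((B - A) * ((y - ln e / 2) / - ln e))
      by (field; lra).
    rewrite Rabs_mult.
    replace (Rabs (B - A) / 2 + Rabs (B - A) * (1 + v) / - ln e) with
      (Rabs (B - A) * ((1 + v - ln e / 2) / - ln e)) by (field; lra).
    apply Rmult_le_compat_l; [apply Rabs_pos|].
    unfold Rdiv at 1; rewrite Rabs_mult, (Rabs_right (/ - ln e)).
    - apply Rmult_le_compat_r; [left; apply Rinv_0_lt_compat; lra|].
      apply Rabs_le; lra.
    - left; apply Rinv_0_lt_compat; lra. }
  destruct (Rle_lt_dec 0 u) as [h|h].
  - rewrite (Rabs_right u) by lra; auto.
  - rewrite (Rabs_left u) by lra.
    rewrite <- (Ropp_involutive u) at 1.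
    rewrite Phi_opp, layer_opp, Rabs_Ropp by lra; apply Hpos; lra.
Qed.

Lemma reaction_bound (e u : R) :
  0 < e < 1 -> Rabs (reaction e (Phi e u)) <= 1 + Rabs u.
Proof.
  intros He.
  assert (Hpos : forall v, 0 <= v -> Rabs (reaction e (Phi e v)) <= 1 + v).
  { intros v Hv.
    assert (Hb := Phi_bounds e (proj1 He) v Hv).
    assert (Hr := root_pos e (proj1 He) (Phi e v)).
    assert (Ha := abs_lt_root e (proj1 He) (Phi e v)).
    set (p := Phi e v) in *; unfold reaction; set (r := sqrt (e + p ^ 2)) in *.
    replace (p * (1 - p ^ 2) / r) with ((p / r) * (1 - p ^ 2)) by (field; lra).
    rewrite Rabs_mult; replace (1 + v) with (1 * (1 + v)) by ring.
    apply Rmult_le_compat; try apply Rabs_pos.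
    - unfold Rdiv; rewrite Rabs_mult, Rabs_inv, (Rabs_right r) by lra.
      apply Rmult_le_reg_r with r; trivial.
      rewrite Rmult_assoc, Rinv_l by lra; lra.
    - apply Rabs_le; nra. }
  destruct (Rle_lt_dec 0 u) as [h|h].
  - rewrite (Rabs_right u) by lra; auto.
  - rewrite (Rabs_left u) by lra.
    rewrite <- (Ropp_involutive u) at 1.
    rewrite Phi_opp, reaction_opp, Rabs_Ropp by lra; apply Hpos; lra.
Qed.

Lemma reaction_deviation (e u d : R) :
  0 < e < 1 -> 0 < d <= u ->
  Rabs (1 - u - reaction e (Phi e u)) <= sqrt e * (2 / sqrt d + 2 * (1 + u)).
Proof.
  intros He Hd; assert (Hu : 0 <= u) by lra.
  assert (Hp := Phi_nonneg e (proj1 He) u Hu); assert (Hb := Phi_bounds e (proj1 He) u Hu).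
  assert (Hr := root_pos e (proj1 He) (Phi e u)).
  assert (Ha := abs_lt_root e (proj1 He) (Phi e u)); rewrite Rabs_right in Ha by lra.
  assert (Hs := sqrt_le_root e (proj1 He) (Phi e u)).
  assert (Hl := root_le e (proj1 He) (Phi e u) Hp).
  assert (Hq := sqrt_lt_R0 e (proj1 He)).
  unfold reaction.
  set (p := Phi e u) in *; set (r := sqrt (e + p ^ 2)) in *; set (q := sqrt e) in *.
  (* [y = 1 - p / r] is the relative error of replacing [r] by [p]; it is at most [q / r], and the
     whole deviation is expressed through [y] and [u - p^2]. *)
  set (y := (r - p) / r).
  assert (Hy : 0 <= y <= 1 /\ r * y <= q).
  { assert (E : r * y = r - p) by (unfold y; field; lra).
    split; [split|]; nra. }
  replace (1 - u - p * (1 - p ^ 2) / r) with (y - ((u - p ^ 2) + p ^ 2 * y))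
    by (unfold y; field; lra).
  assert (Hy2 : 0 <= p ^ 2 * y <= p ^ 2) by nra.
  assert (Hsd := sqrt_lt_R0 d (proj1 Hd)).
  (* Here [d <= u <= p^2 + 2 q p <= 3 r^2], because [p] and [q] are at most [r]. *)
  assert (Hd2 : sqrt d <= 2 * r).
  { apply Rsqr_incr_0_var; [|lra].
    rewrite Rsqr_sqrt by lra; unfold Rsqr; nra. }
  assert (Hy3 : y <= q * (2 / sqrt d)).
  { apply Rmult_le_reg_r with (sqrt d); trivial.
    replace (q * (2 / sqrt d) * sqrt d) with (2 * q) by (field; lra); nra. }
  assert (Hpy : p ^ 2 * y <= q * p) by (replace (p ^ 2 * y) with (p * (p * y)) by ring; nra).
  assert (Hpu : 2 * p <= 1 + u) by (assert (0 <= (1 - p) ^ 2) by apply pow2_ge_0; nra).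
  apply Rabs_le; split; nra.
Qed.

Lemma deviations_small (A B d M rho : R) :
  0 < d -> 0 < M -> 0 < rho ->
  exists e0, 0 < e0 <= 1 /\ forall e u, 0 < e < e0 -> d <= u <= M ->
    Rabs (layer ((A - B) / ln e) e (Phi e u) - (B - A) / 2) <= rho /\
    Rabs (1 - u - reaction e (Phi e u)) <= rho.
Proof.
  intros Hd HM Hrho.
  set (Q := 1 + M + Rabs (ln d) / 2); set (N := 2 / sqrt d + 2 * (1 + M)).
  assert (HQ : 0 < Q) by (unfold Q; assert (H := Rabs_pos (ln d)); lra).
  assert (HN : 0 < N).
  { assert (0 < 2 / sqrt d) by (apply Rdiv_lt_0_compat; [lra | now apply sqrt_lt_R0]).
    unfold N; lra. }
  (* The exponential threshold forces [|B - A| Q <= rho |ln e|], with [Q] a bound for the logarithm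
     in [layer_deviation]; the last one forces [sqrt e <= rho / N], with [N] bounding the factor in
     [reaction_deviation]. *)
  exists (Rmin 1 (Rmin (exp (- (Rabs (B - A) * Q / rho))) ((rho / N) ^ 2))).
  split; [split|].
  - apply Rmin_pos; [lra|]; apply Rmin_pos; [apply exp_pos|].
    apply pow_lt, Rdiv_lt_0_compat; trivial.
  - apply Rmin_l.
  - intros e u [He Hlt] Hu.
    apply Rmin_Rgt_l in Hlt; destruct Hlt as [H1 H2].
    apply Rmin_Rgt_l in H2; destruct H2 as [H2 H3].
    assert (He1 : 0 < e < 1) by lra.
    assert (Hl : ln e < 0) by (rewrite <- ln_1; apply ln_increasing; lra).
    split.
    + rewrite layer_deviation by trivial.
      assert (Hb := ln_shifted_root_bounds e u He1 ltac:(lra)).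
      assert (Hlow := ln_shifted_root_lower e u d He1 ltac:(lra)).
      set (y := ln (Phi e u + _)) in *.
      assert (Hy : Rabs y <= Q).
      { unfold Q; assert (K1 := Rabs_pos (ln d)); assert (K2 := Rabs_maj2 (ln d)).
        apply Rabs_le; lra. }
      assert (Hln : Rabs (B - A) * Q / rho < - ln e).
      { apply ln_increasing in H2; trivial; rewrite ln_exp in H2; lra. }
      unfold Rdiv; rewrite !Rabs_mult, Rabs_inv, (Rabs_left (ln e)), (Rabs_minus_sym A B) by trivial.
      apply Rmult_le_reg_r with (- ln e); [lra|].
      replace (Rabs (B - A) * / - ln e * Rabs y * - ln e) with (Rabs (B - A) * Rabs y)
        by (field; lra).
      apply Rle_trans with (Rabs (B - A) * Q).
      * apply Rmult_le_compat_l; [apply Rabs_pos | trivial].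
      * replace (Rabs (B - A) * Q) with (rho * (Rabs (B - A) * Q / rho)) by (field; lra).
        apply Rmult_le_compat_l; lra.
    + eapply Rle_trans; [apply (reaction_deviation e u d He1); lra|].
      assert (Hs : sqrt e <= rho / N).
      { rewrite <- (sqrt_pow2 (rho / N)) by (left; now apply Rdiv_lt_0_compat).
        apply sqrt_le_1; [lra | apply pow2_ge_0 | lra]. }
      replace rho with (rho / N * N) by (field; lra).
      apply Rmult_le_compat; trivial; [apply sqrt_pos | | unfold N; lra].
      assert (0 < 2 / sqrt d) by (apply Rdiv_lt_0_compat; [lra | now apply sqrt_lt_R0]).
      lra.
Qed.

(** * Convergence on the right of the layer *)

(** The untruncated right branch of [wAB]: the solution of [W'' = W - 1] with [W 0 = 0] and
    [W' 0 = B]. *)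
Definition limit_wave (B x : R) : R := B * sinh x - cosh x + 1.

(** The squared distance of [(w, z)] from the limit trajectory. On the side [w > 0] the limit of
    [layer] is [(B - A) / 2], hence the shift in the second square, which also makes the energy
    vanish at [x = 0]. *)
Definition energy (A B : R) (w z : R -> R) (x : R) : R :=
  (w x - limit_wave B x) ^ 2 + (z x - (B * cosh x - sinh x - (B - A) / 2)) ^ 2.

Lemma is_derive_limit_wave (B x : R) :
  is_derive (limit_wave B) x (B * cosh x - sinh x).
Proof. unfold limit_wave, sinh, cosh; auto_derive; trivial; field. Qed.

Lemma continuous_energy (A B e : R) (w z : R -> R) :
  wave_system A B e w z -> forall x, continuous (energy A B w z) x.
Proof.
  intros (_ & _ & Hw & Hz) x.
  apply (ex_derive_continuous (energy A B w z)); unfold energy, limit_wave, sinh, cosh.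
  auto_derive; split; [eexists; apply Hw | split; [eexists; apply Hz | trivial]].
Qed.

Lemma energy_growth (A B e r a b : R) (w z : R -> R) :
  wave_system A B e w z -> a <= b ->
  (forall t, a <= t <= b ->
     Rabs (layer ((A - B) / ln e) e (Phi e (w t)) - (B - A) / 2) <= r /\
     Rabs (1 - w t - reaction e (Phi e (w t))) <= r) ->
  energy A B w z b <= (energy A B w z a + 2 * r ^ 2 * (b - a)) * exp (3 * (b - a)).
Proof.
  intros (_ & _ & Hw & Hz) Hab Hr.
  set (l := fun t => layer ((A - B) / ln e) e (Phi e (w t))) in *.
  set (g := fun t => reaction e (Phi e (w t))) in *.
  apply gronwall with (dE := fun t =>
    2 * (w t - limit_wave B t) * (z t + l t - (B * cosh t - sinh t)) +
    2 * (z t - (B * cosh t - sinh t - (B - A) / 2)) * (- g t - (B * sinh t - cosh t)));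
    trivial; [lra | assert (H := pow2_ge_0 r); lra | | ].
  - intros t _; unfold energy.
    apply (is_derive_plus (fun x => (w x - limit_wave B x) ^ 2)
             (fun x => (z x - (B * cosh x - sinh x - (B - A) / 2)) ^ 2)).
    + assert (H : is_derive (fun x => w x - limit_wave B x) t (z t + l t - (B * cosh t - sinh t)))
        by (apply (is_derive_minus w (limit_wave B)); [apply Hw | apply is_derive_limit_wave]).
      replace (2 * (w t - limit_wave B t) * (z t + l t - (B * cosh t - sinh t))) with
        (INR 2 * (z t + l t - (B * cosh t - sinh t)) * (w t - limit_wave B t) ^ pred 2)
        by (simpl; ring).
      now apply (is_derive_pow (fun x => w x - limit_wave B x)).
    + assert (H : is_derive (fun x => z x - (B * cosh x - sinh x - (B - A) / 2)) t
                    (- g t - (B * sinh t - cosh t))).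
      { apply (is_derive_minus z (fun x => B * cosh x - sinh x - (B - A) / 2)); [apply Hz|].
        unfold sinh, cosh; auto_derive; trivial; field. }
      replace (2 * (z t - (B * cosh t - sinh t - (B - A) / 2)) * (- g t - (B * sinh t - cosh t))) with
        (INR 2 * (- g t - (B * sinh t - cosh t))
           * (z t - (B * cosh t - sinh t - (B - A) / 2)) ^ pred 2)
        by (simpl; ring).
      now apply (is_derive_pow (fun x => z x - (B * cosh x - sinh x - (B - A) / 2))).
  - intros t Ht; destruct (Hr t Ht) as [H1 H2].
    assert (Hsq : forall x, Rabs x <= r -> x ^ 2 <= r ^ 2).
    { intros x Hx; rewrite <- (pow2_abs x); apply pow_incr; split; [apply Rabs_pos | trivial]. }
    apply Hsq in H1; apply Hsq in H2; change (reaction e (Phi e (w t))) with (g t) in H2.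
    change (layer ((A - B) / ln e) e (Phi e (w t))) with (l t) in H1.
    unfold energy.
    set (p := w t - limit_wave B t); set (q := z t - (B * cosh t - sinh t - (B - A) / 2)).
    set (al := l t - (B - A) / 2) in *; set (be := 1 - w t - g t) in *.
    replace (z t + l t - (B * cosh t - sinh t)) with (q + al) by (unfold q, al; lra).
    replace (- g t - (B * sinh t - cosh t)) with (p + be)
      by (unfold p, be, limit_wave; lra).
    (* The derivative is [4 p q + 2 p al + 2 q be]; these three squares bound it by
       [3 (p^2 + q^2) + al^2 + be^2]. *)
    assert (0 <= (p - q) ^ 2) by apply pow2_ge_0.
    assert (0 <= (p - al) ^ 2) by apply pow2_ge_0.
    assert (0 <= (q - be) ^ 2) by apply pow2_ge_0.
    nra.
Qed.

(** Close to 0 the deviations are merely bounded, by [r], so the energy is only of order [x]. Still,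
    [layer] cannot outweigh [z], and [w] leaves 0 at a linear rate that does not depend on [e]. *)
Lemma initial_layer (A B : R) :
  0 < A -> 0 < B ->
  exists tau kap r e0, 0 < tau /\ 0 < kap /\ 0 < r /\ 0 < e0 <= 1 /\
    forall e w z, 0 < e < e0 -> wave_system A B e w z ->
    forall x, 0 <= x <= tau ->
      kap * x <= w x /\
      energy A B w z x <= 2 * r ^ 2 * x * exp (3 * x).
Proof.
  intros HA HB.
  (* [m] is the minimum of [A] and [B]. *)
  set (D := Rabs (B - A)); set (m := (A + B) / 2 - D / 2).
  assert (HD : 0 <= D) by apply Rabs_pos.
  assert (Hm : 0 < m) by (unfold m, D, Rabs; destruct (Rcase_abs (B - A)); lra).
  (* For [x <= m / 8] the drift of [z] costs at most [m / 4], and this choice of [e0] lets [layer]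
     exceed [D / 2] by at most [m / 4]; a slope of [m / 2] is left. The second bound on [x] keeps
     [w <= 1/2], and [D + m + 4] dominates both deviations. *)
  exists (Rmin (m / 8) (/ (4 * (A + B)))), (m / 2), (D + m + 4), (exp (- (8 * D / m))).
  assert (Hi : 0 < / (4 * (A + B))) by (apply Rinv_0_lt_compat; lra).
  assert (HDm : 0 <= 8 * D / m).
  { apply Rmult_le_pos; [lra | left; now apply Rinv_0_lt_compat]. }
  split; [apply Rmin_pos; lra|]; split; [lra|]; split; [lra|].
  assert (Hexp : exp (- (8 * D / m)) <= 1).
  { rewrite <- exp_0; destruct HDm as [h|h]; [left; apply exp_increasing; lra|].
    rewrite <- h, Ropp_0; lra. }
  split; [split; [apply exp_pos | trivial]|].
  intros e w z He Hs; assert (He1 : 0 < e < 1) by lra.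
  assert (Hl : 8 * D / m < - ln e).
  { destruct He as [He0 He]; apply ln_increasing in He; trivial; rewrite ln_exp in He; lra. }
  assert (Hlay : forall u, Rabs u <= 1 ->
            Rabs (layer ((A - B) / ln e) e (Phi e u)) <= D / 2 + m / 4).
  { intros u Hu; eapply Rle_trans; [apply layer_bound; trivial|]; fold D.
    apply Rplus_le_compat_l.
    apply Rmult_le_reg_r with (- ln e); [lra|].
    unfold Rdiv at 1; rewrite Rmult_assoc, Rinv_l, Rmult_1_r by lra.
    apply Rle_trans with (D * 2); [apply Rmult_le_compat_l; lra|].
    replace (D * 2) with (m / 4 * (8 * D / m)) by (field; lra).
    apply Rmult_le_compat_l; lra. }
  assert (Hrea : forall u, Rabs u <= 1 -> Rabs (reaction e (Phi e u)) <= 2).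
  { intros u Hu; assert (H := reaction_bound e u He1); lra. }
  pose proof Hs as (Hw0 & Hz0 & Hw & Hz).
  set (tau := Rmin _ _).
  assert (Htau : tau <= m / 8 /\ (A + B) * tau <= / 4).
  { split; [apply Rmin_l|].
    replace (/ 4) with ((A + B) * / (4 * (A + B))) by (field; lra).
    apply Rmult_le_compat_l; [lra | apply Rmin_r]. }
  assert (Hstep : forall x, 0 <= x <= tau -> (forall t, 0 <= t <= x -> Rabs (w t) <= 1) ->
            m / 2 * x <= w x <= 2 * (A + B) * x).
  { intros x Hx Hb.
    assert (Hzb : forall t, 0 <= t <= x -> (A + B) / 2 - 2 * t <= z t <= (A + B) / 2 + 2 * t).
    { intros t Ht; rewrite <- Hz0; split.
      - assert (H : z 0 + 2 * 0 <= z t + 2 * t); [|lra].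
        apply (derive_nonneg_le (fun s => z s + 2 * s)
                 (fun s => - reaction e (Phi e (w s)) + 2)); [lra| |].
        + intros s _; apply (is_derive_plus z (fun s => 2 * s)); [apply Hz|].
          auto_derive; trivial; ring.
        + intros s Hs'; assert (H := Hrea _ (Hb s ltac:(lra))).
          apply Rabs_le_between in H; lra.
      - assert (H : 2 * 0 - z 0 <= 2 * t - z t); [|lra].
        apply (derive_nonneg_le (fun s => 2 * s - z s)
                 (fun s => 2 - - reaction e (Phi e (w s)))); [lra| |].
        + intros s _; apply (is_derive_minus (fun s => 2 * s) z); [|apply Hz].
          auto_derive; trivial; ring.
        + intros s Hs'; assert (H := Hrea _ (Hb s ltac:(lra))).
          apply Rabs_le_between in H; lra. }
    split.
    - assert (H : w 0 - m / 2 * 0 <= w x - m / 2 * x); [|lra].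
      apply (derive_nonneg_le (fun s => w s - m / 2 * s)
               (fun s => z s + layer ((A - B) / ln e) e (Phi e (w s)) - m / 2)); [lra| |].
      + intros s _; apply (is_derive_minus w (fun s => m / 2 * s)); [apply Hw|].
        auto_derive; trivial; ring.
      + intros s Hs'; assert (H := Hlay _ (Hb s ltac:(lra))).
        apply Rabs_le_between in H; assert (H1 := Hzb s ltac:(lra)); unfold m in *; lra.
    - assert (H : 2 * (A + B) * 0 - w 0 <= 2 * (A + B) * x - w x); [|lra].
      apply (derive_nonneg_le (fun s => 2 * (A + B) * s - w s)
               (fun s => 2 * (A + B) - (z s + layer ((A - B) / ln e) e (Phi e (w s))))); [lra| |].
      + intros s _; apply (is_derive_minus (fun s => 2 * (A + B) * s) w); [|apply Hw].
        auto_derive; trivial; ring.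
      + intros s Hs'; assert (H := Hlay _ (Hb s ltac:(lra))).
        apply Rabs_le_between in H; assert (H1 := Hzb s ltac:(lra)); unfold m in *; lra. }
  assert (Hcw : forall x, continuous w x).
  { intros x; apply (ex_derive_continuous w); eexists; apply Hw. }
  (* The a priori bound assumed in [Hstep] improves itself from 1 to [1/2], so [continuation]
     removes the assumption. *)
  assert (Hw1 : forall x, 0 <= x <= tau -> Rabs (w x) <= 1).
  { intros x Hx; assert (H : 0 < 1 - Rabs (w x)); [|lra].
    apply (continuation (fun x => 1 - Rabs (w x)) 0 tau); trivial.
    - intros y; apply (continuous_minus (fun _ => 1) (fun y => Rabs (w y))).
      + apply continuous_const.
      + apply (continuous_comp w Rabs); [apply Hcw | apply continuous_Rabs].
    - rewrite Hw0, Rabs_R0; lra.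
    - intros y Hy Hb; destruct (Hstep y Hy) as [h1 h2].
      + intros t Ht; specialize (Hb t Ht); lra.
      + rewrite Rabs_right; nra. }
  intros x Hx; split.
  - apply Hstep; trivial; intros t Ht; apply Hw1; lra.
  - assert (H := energy_growth A B e (D + m + 4) 0 x w z Hs (proj1 Hx)).
    assert (H0 : energy A B w z 0 = 0).
    { unfold energy, limit_wave; rewrite Hw0, Hz0, sinh_0, cosh_0; field. }
    rewrite H0, Rminus_0_r, Rplus_0_l in H; apply H.
    intros t Ht; assert (Ht1 := Hw1 t ltac:(lra)).
    assert (H1 := Hlay _ Ht1); assert (H2 := Hrea _ Ht1).
    assert (HDb : Rabs ((B - A) / 2) = D / 2).
    { unfold Rdiv; rewrite Rabs_mult, (Rabs_right (/ 2)) by lra; reflexivity. }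
    split.
    + eapply Rle_trans; [apply Rabs_triang|]; rewrite Rabs_Ropp, HDb; lra.
    + apply Rabs_le_between in Ht1; apply Rabs_le_between in H2; apply Rabs_le; lra.
Qed.

(** While the energy is at most [th^2], [w] stays in [[d, M]] beyond [tau], so the deviations are at
    most [rho], and Gronwall returns the energy bound [th^2 / 2]; [continuation] closes the loop. *)
Lemma right_convergence (A B X eta : R) :
  0 < A -> 0 < B -> 0 < X -> 0 < eta ->
  (forall x, 0 < x <= X -> 0 < limit_wave B x) ->
  exists e0, 0 < e0 <= 1 /\
    forall e w z, 0 < e < e0 -> wave_system A B e w z ->
    forall x, 0 <= x <= X -> Rabs (w x - limit_wave B x) < eta.
Proof.
  intros HA HB HX Heta Hpos.
  destruct (initial_layer A B HA HB) as (tau0 & kap & r & e1 & Ht0 & Hk & Hr & He1 & Hinit).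
  (* Two times avoid circularity: [tau1] fixes the minimum [mu] of the limit wave and hence [th];
     only then is the shorter [tau] chosen in terms of [th]. *)
  set (tau1 := Rmin tau0 X).
  assert (Ht1 : 0 < tau1) by (now apply Rmin_pos).
  assert (Ht1' : tau1 <= tau0 /\ tau1 <= X) by (split; [apply Rmin_l | apply Rmin_r]).
  destruct (continuity_ab_min (limit_wave B) tau1 X) as [mn [Hmn Hmn']]; [lra| |].
  { intros c _; apply derivable_continuous_pt; eexists.
    apply is_derive_Reals, is_derive_limit_wave. }
  set (mu := limit_wave B mn) in *.
  assert (Hmu : 0 < mu) by (apply Hpos; lra).
  (* Half of [eta] gives the strict conclusion, [mu / 2] keeps [w >= mu / 2] after [tau1], and 1
     keeps [w] below [M]. *)
  set (th := Rmin (Rmin (eta / 2) (mu / 2)) 1).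
  assert (Hth : 0 < th) by (unfold th; repeat apply Rmin_pos; lra).
  assert (Hth' : th <= eta / 2 /\ th <= mu / 2 /\ th <= 1).
  { unfold th; repeat split; [| |apply Rmin_r];
      (eapply Rle_trans; [apply Rmin_l | first [apply Rmin_l | apply Rmin_r]]). }
  set (G := exp (3 * X)).
  assert (HG : 1 <= G) by (unfold G; assert (H := exp_ineq1_le (3 * X)); lra).
  assert (HGle : forall y, y <= X -> exp (3 * y) <= G).
  { intros y [Hy|Hy]; [left; apply exp_increasing; lra | right; now subst y]. }
  (* The energy accumulated up to [tau], amplified by the later Gronwall factor [G], is at most
     [th^2 / 4]. *)
  set (tau := Rmin tau1 (th ^ 2 / (8 * r ^ 2 * G ^ 2))).
  assert (Hr2 : 0 < r ^ 2) by now apply pow_lt.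
  assert (HG2 : 0 < G ^ 2) by (apply pow_lt; lra).
  assert (Hth2 : 0 < th ^ 2) by now apply pow_lt.
  assert (Htau : 0 < tau).
  { apply Rmin_pos; trivial; apply Rdiv_lt_0_compat; trivial.
    repeat apply Rmult_lt_0_compat; lra. }
  assert (Htau1 : tau <= tau1) by apply Rmin_l.
  assert (Htau2 : 2 * r ^ 2 * tau * G * G <= th ^ 2 / 4).
  { apply Rle_trans with (2 * r ^ 2 * G ^ 2 * (th ^ 2 / (8 * r ^ 2 * G ^ 2))).
    - replace (2 * r ^ 2 * tau * G * G) with (2 * r ^ 2 * G ^ 2 * tau) by ring.
      apply Rmult_le_compat_l; [|apply Rmin_r].
      left; repeat apply Rmult_lt_0_compat; lra.
    - right; field; lra. }
  set (d := Rmin (kap * tau) (mu / 2)).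
  assert (Hd : 0 < d) by (apply Rmin_pos; [now apply Rmult_lt_0_compat | lra]).
  assert (Hd' : d <= kap * tau /\ d <= mu / 2) by (split; [apply Rmin_l | apply Rmin_r]).
  set (M := B * exp X + 1).
  assert (HM : 0 < M) by (unfold M; assert (H := exp_pos X); nra).
  assert (Hlim : forall t, t <= X -> limit_wave B t <= B * exp X).
  { intros t Ht; unfold limit_wave, sinh, cosh.
    assert (H1 : exp t <= exp X) by (destruct Ht as [h|h]; [left; now apply exp_increasing | right; now subst t]).
    assert (H2 := exp_pos t); assert (H3 := exp_pos (- t)).
    assert (H4 := exp_ineq1_le t); assert (H5 := exp_ineq1_le (- t)); nra. }
  (* Chosen so that the forcing term of the Gronwall estimate on [[tau, X]] contributes at most
     [th^2 / 4]. *)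
  set (rho := sqrt (th ^ 2 / (8 * X * G))).
  assert (Hq : 0 < th ^ 2 / (8 * X * G)).
  { apply Rdiv_lt_0_compat; trivial; repeat apply Rmult_lt_0_compat; lra. }
  assert (Hrho : 0 < rho) by now apply sqrt_lt_R0.
  assert (Hrho2 : 2 * rho ^ 2 * X * G = th ^ 2 / 4).
  { unfold rho; rewrite pow2_sqrt by lra; field; lra. }
  destruct (deviations_small A B d M rho Hd HM Hrho) as (e2 & He2 & Hdev).
  exists (Rmin e1 e2); split.
  { split; [apply Rmin_pos; lra | eapply Rle_trans; [apply Rmin_l | lra]]. }
  intros e w z [He Hlt] Hs.
  apply Rmin_Rgt_l in Hlt; destruct Hlt as [Hlt1 Hlt2].
  specialize (Hinit e w z (conj He Hlt1) Hs).
  assert (Hclose : forall x y, 0 <= y -> energy A B w z x <= y ^ 2 -> Rabs (w x - limit_wave B x) <= y).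
  { intros x y Hy Hx; unfold energy in Hx.
    assert (H := pow2_ge_0 (z x - (B * cosh x - sinh x - (B - A) / 2))).
    apply Rsqr_incr_0_var; trivial; rewrite <- Rsqr_abs; unfold Rsqr; lra. }
  assert (Hearly : forall x, 0 <= x <= tau -> energy A B w z x * G <= th ^ 2 / 4).
  { intros x Hx; destruct (Hinit x ltac:(lra)) as [_ H].
    assert (Hexp := HGle x ltac:(lra)); assert (Hex := exp_pos (3 * x)).
    apply Rle_trans with (2 * r ^ 2 * tau * G * G); trivial.
    apply Rmult_le_compat_r; [lra|].
    eapply Rle_trans; [apply H|].
    apply Rmult_le_compat; [|lra| |trivial].
    - apply Rmult_le_pos; lra.
    - apply Rmult_le_compat_l; lra. }
  assert (Hen0 : forall x, 0 <= energy A B w z x).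
  { intros x; unfold energy; assert (H1 := pow2_ge_0 (w x - limit_wave B x)).
    assert (H2 := pow2_ge_0 (z x - (B * cosh x - sinh x - (B - A) / 2))); lra. }
  assert (Hall : forall x, 0 <= x <= X -> energy A B w z x <= th ^ 2).
  { intros x Hx; destruct (Rle_lt_dec x tau) as [h|h].
    { assert (H := Hearly x ltac:(lra)); assert (H1 := Hen0 x); nra. }
    assert (Ht : energy A B w z tau * G <= th ^ 2 / 4) by (apply Hearly; lra).
    assert (H : 0 < th ^ 2 - energy A B w z x); [|lra].
    apply (continuation (fun x => th ^ 2 - energy A B w z x) tau X); [| | |lra].
    - intros y; apply (continuous_minus (fun _ => th ^ 2) (energy A B w z)).
      + apply continuous_const.
      + now apply continuous_energy with e.
    - assert (H1 := Hen0 tau); nra.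
    - intros y Hy Hb.
      assert (H := energy_growth A B e rho tau y w z Hs (proj1 Hy)).
      assert (Hgr : energy A B w z y <= th ^ 2 / 2).
      { eapply Rle_trans; [apply H|].
        - intros t Ht'; apply Hdev; [lra|].
          assert (Hc := Hclose t th (Rlt_le _ _ Hth)).
          specialize (Hb t Ht'); specialize (Hc ltac:(lra)).
          apply Rabs_le_between in Hc; split.
          (* Up to [tau1] the linear growth from [initial_layer] gives [w >= kap * tau]; later,
             closeness to the limit wave gives [w >= mu / 2]. *)
          + destruct (Rle_lt_dec t tau1) as [k|k].
            * destruct (Hinit t ltac:(lra)) as [Hi _].
              assert (kap * tau <= kap * t) by (apply Rmult_le_compat_l; lra); lra.
            * specialize (Hmn t ltac:(lra)); lra.
          + specialize (Hlim t ltac:(lra)); unfold M; lra.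
        - assert (Hexp := HGle (y - tau) ltac:(lra)); assert (Hex := exp_pos (3 * (y - tau))).
          assert (Hrr : 0 <= rho ^ 2) by apply pow2_ge_0.
          assert (H1 := Hen0 tau).
          apply Rle_trans with ((energy A B w z tau + 2 * rho ^ 2 * X) * G); [|lra].
          apply Rmult_le_compat; [nra|lra| |trivial].
          apply Rplus_le_compat_l, Rmult_le_compat_l; lra. }
      lra. }
  intros x Hx; apply Rle_lt_trans with th; [apply Hclose; [lra | now apply Hall] | lra].
Qed.

(** * Compact subsets of J and the equation *)

Lemma J_right_pos (B : R) : 0 < B -> Rbar_lt 0 (J_right B).
Proof.
  intros HB; unfold J_right; destruct (Rle_dec 1 B) as [h|h]; simpl; trivial.
  rewrite <- ln_1; apply ln_increasing; [lra|].
  apply Rmult_lt_reg_r with (1 - B); [lra|].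
  unfold Rdiv; rewrite Rmult_assoc, Rinv_l; lra.
Qed.

(** From the factorization [2 e^x W(x) = (e^x - 1) (e^x (B - 1) + B + 1)]: for [B < 1] the second
    factor vanishes exactly where [e^x = (1 + B) / (1 - B)]. *)
Lemma limit_wave_pos (B X : R) :
  0 < B -> Rbar_lt X (J_right B) -> forall x, 0 < x <= X -> 0 < limit_wave B x.
Proof.
  intros HB HX x Hx.
  assert (Hq : 1 < exp x) by (rewrite <- exp_0; apply exp_increasing; lra).
  assert (HqB : 0 < exp x * (B - 1) + B + 1).
  { unfold J_right in HX; destruct (Rle_dec 1 B) as [h|h]; [nra|]; simpl in HX.
    assert (H : exp x < (1 + B) / (1 - B)).
    { rewrite <- (exp_ln ((1 + B) / (1 - B))) by (apply Rdiv_lt_0_compat; lra).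
      apply exp_increasing; lra. }
    apply (Rmult_lt_compat_r (1 - B)) in H; [|lra].
    unfold Rdiv in H; rewrite Rmult_assoc, Rinv_l in H; lra. }
  apply Rmult_lt_reg_l with (2 * exp x); [lra|]; rewrite Rmult_0_r.
  replace (2 * exp x * limit_wave B x) with ((exp x - 1) * (exp x * (B - 1) + B + 1)).
  - apply Rmult_lt_0_compat; lra.
  - unfold limit_wave, sinh, cosh; rewrite exp_Ropp; field; lra.
Qed.

Lemma wAB_nonneg (A B X x : R) :
  0 < B -> Rbar_lt X (J_right B) -> 0 <= x <= X -> wAB A B x = limit_wave B x.
Proof.
  intros HB HX Hx; unfold wAB; destruct (Rle_dec x 0) as [h|h].
  - replace x with 0 by lra; unfold limit_wave.
    rewrite sinh_0, cosh_0, Rmin_left; lra.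
  - assert (H := limit_wave_pos B X HB HX x ltac:(lra)).
    unfold limit_wave in *; rewrite Rmax_left; lra.
Qed.

Lemma sinh_opp (x : R) : sinh (- x) = - sinh x.
Proof. unfold sinh; rewrite Ropp_involutive; field. Qed.

Lemma cosh_opp (x : R) : cosh (- x) = cosh x.
Proof. unfold cosh; rewrite Ropp_involutive; field. Qed.

Lemma wAB_opp (A B x : R) : wAB A B (- x) = - wAB B A x.
Proof.
  unfold wAB; destruct (Rle_dec (- x) 0) as [h|h]; destruct (Rle_dec x 0) as [k|k].
  - replace x with 0 by lra; rewrite Ropp_0, sinh_0, cosh_0, !Rmin_left; lra.
  - rewrite sinh_opp, cosh_opp; unfold Rmin, Rmax.
    destruct Rle_dec; destruct Rle_dec; lra.
  - rewrite sinh_opp, cosh_opp; unfold Rmin, Rmax.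
    destruct Rle_dec; destruct Rle_dec; lra.
  - lra.
Qed.

Lemma J_left_opp (A : R) : J_left A = Rbar_opp (J_right A).
Proof. unfold J_left, J_right; now destruct (Rle_dec 1 A). Qed.

Lemma right_uniform (A B X eta : R) (w : R -> R -> R) :
  0 < A -> 0 < B -> 0 < eta -> Rbar_lt X (J_right B) ->
  (forall e, 0 < e < 1 -> exists z, wave_system A B e (w e) z) ->
  exists d, 0 < d <= 1 /\ forall e, 0 < e < d ->
    forall x, 0 <= x <= X -> Rabs (w e x - wAB A B x) < eta.
Proof.
  intros HA HB Heta HX Hw.
  destruct (Rlt_le_dec 0 X) as [h|h].
  - destruct (right_convergence A B X eta HA HB h Heta (limit_wave_pos B X HB HX))
      as (d & Hd & H).
    exists d; split; trivial; intros e He x Hx.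
    rewrite (wAB_nonneg A B X x) by trivial.
    destruct (Hw e) as [z Hz]; [lra|]; now apply (H e (w e) z).
  (* If [X <= 0], the only possible point is [x = 0], where both functions vanish. *)
  - exists 1; split; [lra|]; intros e He x Hx.
    destruct (Hw e He) as [z [Hz _]].
    replace x with 0 by lra; rewrite Hz.
    rewrite (wAB_nonneg A B 0 0); [|trivial|now apply J_right_pos|lra].
    unfold limit_wave; rewrite sinh_0, cosh_0.
    replace (0 - _) with 0 by ring; now rewrite Rabs_R0.
Qed.

(** The supremum of a nonempty compact set belongs to it, hence lies strictly below [b]. The empty
    set is served by the bound 0. *)
Lemma compact_bounded_inside (K : R -> Prop) (b : Rbar) :
  compact K -> Rbar_lt 0 b -> (forall x, K x -> Rbar_lt x b) ->
  exists X : R, Rbar_lt X b /\ forall x, K x -> x <= X.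
Proof.
  intros HK Hb HKb.
  destruct (classic (exists x, K x)) as [Hne|Hempty].
  2:{ exists 0; split; trivial; intros x Hx; exfalso; eauto. }
  destruct (compact_P1 K HK) as (lo & hi & Hbd).
  destruct (completeness K) as [X [Hub Hlub]]; trivial.
  { exists hi; intros x Hx; now apply Hbd. }
  exists X; split; [|exact Hub]; apply HKb.
  destruct (classic (K X)) as [h|h]; trivial; exfalso.
  destruct (compact_P2 K HK X h) as [d Hd].
  assert (Hd0 := cond_pos d).
  assert (X <= X - d / 2); [|lra].
  apply Hlub; intros x Hx.
  destruct (Rle_lt_dec x (X - d / 2)) as [k|k]; trivial; exfalso.
  apply (Hd x); trivial; unfold disc.
  specialize (Hub x Hx); rewrite Rabs_left1; lra.
Qed.

(** The chain rule in time produces the factor [- c], while a translation in space leaves the second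
    derivative unchanged; what remains is [wave_profile_equation]. *)
Lemma travelling_wave_PDE (A B e : R) (w z : R -> R) :
  0 < e < 1 -> wave_system A B e w z ->
  forall x t, let p := Phi e (w (x - speed A B e * t)) in
    Derive (fun s => w (x - speed A B e * s)) t =
      (e + p ^ 2) * Derive_n (fun y => w (y - speed A B e * t)) 2 x
      + p * (1 - p ^ 2) * sqrt (e + p ^ 2).
Proof.
  intros He Hs x t p; set (c := speed A B e) in *.
  unfold Rminus at 2; rewrite (Derive_n_comp_trans w 2 x (- (c * t))).
  change (Derive_n w 2 (x + - (c * t))) with (Derive (Derive w) (x - c * t)).
  unfold p, c; rewrite <- (wave_profile_equation A B e w z He Hs); fold c.
  apply is_derive_unique.
  apply (is_derive_comp w (fun s => x - c * s)).
  - apply Derive_correct; destruct Hs as (_ & _ & Hw & _); eexists; apply Hw.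
  - auto_derive; trivial; ring.
Qed.

Theorem theorem4p3 :
  forall A B : R, 0 < A -> 0 < B ->
  exists (w : R -> R -> R) (a b : R -> Rbar),
    (forall eps, 0 < eps < 1 ->
       (* w eps is defined on the open interval (a eps, b eps) containing 0 *)
       Rbar_lt (a eps) 0 /\ Rbar_lt 0 (b eps) /\
       (* twice differentiable there *)
       (exists w1 w2 : R -> R, forall y, in_open (a eps) (b eps) y ->
          is_derive (w eps) y (w1 y) /\ is_derive w1 y (w2 y)) /\
       w eps 0 = 0 /\
       (* u(x,t) = w eps (x - c_eps t) solves the PDE *)
       (forall x t, in_open (a eps) (b eps) (x - speed A B eps * t) ->
          let uxt := w eps (x - speed A B eps * t) in
          Derive (fun s => w eps (x - speed A B eps * s)) t =
            (eps + (Phi eps uxt) ^ 2)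
              * Derive_n (fun y => w eps (y - speed A B eps * t)) 2 x
            + Phi eps uxt * (1 - (Phi eps uxt) ^ 2)
              * sqrt (eps + (Phi eps uxt) ^ 2))) /\
    (* convergence in C_loc(J_AB) as eps -> 0 *)
    (forall K : R -> Prop, compact K ->
       (forall x, K x -> in_open (J_left A) (J_right B) x) ->
       (exists d, 0 < d /\ forall eps, 0 < eps < d ->
          forall x, K x -> in_open (a eps) (b eps) x) /\
       (forall eta, 0 < eta -> exists d, 0 < d /\ forall eps, 0 < eps < d ->
          forall x, K x -> Rabs (w eps x - wAB A B x) < eta)).
Proof.
  intros A B HA HB.
  destruct (choice (fun e w => 0 < e -> exists z, wave_system A B e w z)) as [w Hw].
  { intros e; destruct (Rlt_le_dec 0 e) as [He|He].
    - destruct (wave_system_exists A B e He) as [w Hz]; now exists w.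
    - exists (fun _ => 0); lra. }
  (* The profiles are global, so every interval of definition is the whole line. *)
  exists w, (fun _ => m_infty), (fun _ => p_infty); split.
  - intros e He; destruct (Hw e (proj1 He)) as [z Hz].
    split; [|split; [|split; [|split]]]; simpl; trivial.
    + exists (fun y => z y + layer ((A - B) / ln e) e (Phi e (w e y))); eexists.
      intros y _; split; [apply Hz | apply (wave_second_derivative _ _ _ _ _ (proj1 He) Hz)].
    + apply Hz.
    + intros x t _; now apply (travelling_wave_PDE A B e (w e) z).
  - intros K HK HJ; split.
    { exists 1; split; [lra|]; intros; split; exact I. }
    intros eta Heta.
    destruct (compact_bounded_inside K (J_right B) HK) as (X & HX & HKX).
    { now apply J_right_pos. }
    { intros x Hx; apply (HJ x Hx). }
    (* An upper bound for the mirror image of [K] is a lower bound for [K] inside [J_left A]. *)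
    destruct (compact_bounded_inside (image_dir Ropp K) (J_right A)) as (Y & HY & HKY).
    { apply continuity_compact; trivial; intros x; apply derivable_continuous_pt.
      apply derivable_pt_opp, derivable_pt_id. }
    { now apply J_right_pos. }
    { intros y (x & -> & Hx); destruct (HJ x Hx) as [Hl _].
      rewrite J_left_opp in Hl; apply Rbar_opp_lt in Hl; now rewrite Rbar_opp_involutive in Hl. }
    destruct (right_uniform A B X eta w HA HB Heta HX) as (d1 & Hd1 & H1).
    { intros e He; now apply Hw. }
    (* The negative half of [K] is handled by the reflected profiles, with [A] and [B] exchanged. *)
    destruct (right_uniform B A Y eta (fun e x => - w e (- x)) HB HA Heta HY)
      as (d2 & Hd2 & H2).
    { intros e He; destruct (Hw e (proj1 He)) as [z Hz].
      exists (fun x => z (- x)); now apply wave_system_reflect. }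
    exists (Rmin d1 d2); split; [apply Rmin_pos; lra|].
    intros e [He Hlt] x Hx; apply Rmin_Rgt_l in Hlt.
    destruct (Rle_lt_dec 0 x) as [h|h].
    + apply H1; [lra|]; split; auto.
    + assert (Hy : - x <= Y) by (apply HKY; now exists x).
      specialize (H2 e ltac:(lra) (- x) ltac:(lra)).
      rewrite wAB_opp, Ropp_involutive in H2.
      rewrite <- Rabs_Ropp; replace (- (w e x - wAB A B x)) with (- w e x - - wAB A B x) by ring.
      exact H2.
Qed.
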